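(* Let $R=K[C]$ be an affine semigroup ring and let $M$ be a finitely generated $\mathbb{Z}^d$-graded $R$-module which is $\overline C$-graded. Then $H^i_{\mathfrak m}(M)$ has finite length if and only if $[H^i_{\mathfrak m}(M)]_a=0$ for all $a\in\Psi_C$.
   Context: $K$ a field; $C\subset\mathbb{Z}^d$ an affine semigroup (finitely generated submonoid) with $\mathbb{Z}C=\mathbb{Z}^d$, $C\cap(-C)=\{0\}$ (not necessarily normal); $R=K[C]=\bigoplus_{c\in C}Kx^c$, $\mathbb{Z}^d$-graded, $\mathfrak m=(x^c\mid0\ne c\in C)$. Let $\mathbf P=\mathbb{R}_{\ge0}C$ and let $h_1,\dots,h_t\in(\mathbb{R}^d)^*$ be a minimal system of linear forms with $\mathbf P=\{u\mid h_j(u)\ge0\ \forall j\}$ (one for each facet). For $u\in\mathbb{R}^d$, $\operatorname{supp}_+(u)=\{j\mid h_j(u)>0\}$. $\overline C=\mathbb{Z}^d\cap\mathbf P$; a $\mathbb{Z}^d$-graded module $M$ is $\overline C$-graded if $M_a=0$ for $a\notin\overline C$. $\Psi_C=\{a\in\mathbb{Z}^d\mid \operatorname{supp}_+(-a)\supseteq\operatorname{supp}_+(c)\text{ for some }0\neq c\in C\}$. *)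

(* Defs.v *)
From HB Require Import structures.
From mathcomp Require Import all_boot all_order all_algebra.
Set Implicit Arguments. Unset Strict Implicit. Unset Printing Implicit Defensive.
Import Order.TTheory GRing.Theory Num.Theory.
Local Open Scope ring_scope.

(* Lattice points: Z^d is 'rV[int]_d.  The affine semigroup C is given by a
   finite family of nonzero generators gens : 'I_k -> Z^d. *)

Definition inC (d k : nat) (gens : 'I_k -> 'rV[int]_d) (c : 'rV[int]_d) : Prop :=
  exists m : 'I_k -> nat, c = \sum_(l < k) gens l *+ m l.

Definition generates_group (d k : nat) (gens : 'I_k -> 'rV[int]_d) : Prop :=
  forall a : 'rV[int]_d, exists z : 'I_k -> int, a = \sum_(l < k) gens l *~ z l.

Definition pointed (d k : nat) (gens : 'I_k -> 'rV[int]_d) : Prop :=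
  forall c, inC gens c -> inC gens (- c) -> c = 0.

Definition toR (R : realFieldType) (d : nat) (a : 'rV[int]_d) : 'rV[R]_d :=
  map_mx (fun z : int => z%:~R) a.

Definition in_cone (R : realFieldType) (d k : nat) (gens : 'I_k -> 'rV[int]_d)
  (u : 'rV[R]_d) : Prop :=
  exists lam : 'I_k -> R, (forall l, 0 <= lam l) /\
    u = \sum_(l < k) lam l *: toR R (gens l).

Definition hf (R : realFieldType) (d : nat) (h u : 'rV[R]_d) : R :=
  \sum_(i < d) h 0 i * u 0 i.

Definition facet_system (R : realFieldType) (d k t : nat)
  (gens : 'I_k -> 'rV[int]_d) (h : 'I_t -> 'rV[R]_d) : Prop :=
  (forall u : 'rV[R]_d, in_cone gens u <-> (forall j, 0 <= hf (h j) u)) /\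
  (forall j0 : 'I_t, exists u : 'rV[R]_d,
      (forall j, j != j0 -> 0 <= hf (h j) u) /\ ~ in_cone gens u).

Definition Psi (R : realFieldType) (d k t : nat) (gens : 'I_k -> 'rV[int]_d)
  (h : 'I_t -> 'rV[R]_d) (a : 'rV[int]_d) : Prop :=
  exists c, inC gens c /\ c != 0 /\
    (forall j, 0 < hf (h j) (toR R c) -> 0 < hf (h j) (toR R (- a))).

(* A Z^d-graded K[C]-module M is encoded by its graded pieces M a (K-vector
   spaces) and the multiplication maps  x^(b-a) : M a -> M b  (meaningful
   when b - a \in C), subject to the module axioms. *)
Definition graded_module (K : fieldType) (d k : nat) (gens : 'I_k -> 'rV[int]_d)
  (M : 'rV[int]_d -> lmodType K) (act : forall a b, {linear M a -> M b}) : Prop :=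
  (forall a (v : M a), act a a v = v) /\
  (forall a b c (v : M a), inC gens (b - a) -> inC gens (c - b) ->
      act b c (act a b v) = act a c v).

Definition fin_gen (K : fieldType) (d k : nat) (gens : 'I_k -> 'rV[int]_d)
  (M : 'rV[int]_d -> lmodType K) (act : forall a b, {linear M a -> M b}) : Prop :=
  exists (p : nat) (deg : 'I_p -> 'rV[int]_d) (g : forall l, M (deg l)),
    forall b (v : M b), exists coef : 'I_p -> K,
      (forall l, ~ inC gens (b - deg l) -> coef l = 0) /\
      v = \sum_(l < p) coef l *: act (deg l) b (g l).

Definition Cbar_graded (K : fieldType) (R : realFieldType) (d k : nat)
  (gens : 'I_k -> 'rV[int]_d) (M : 'rV[int]_d -> lmodType K) : Prop :=
  forall a, ~ in_cone gens (toR R a) -> forall v : M a, v = 0.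

(* ---- Local cohomology via the Cech complex on x^(gens l), l < k ---- *)
(* A degree-a cochain of the Cech complex is represented by a common
   exponent n and, for every S \subseteq {0..k-1}, an element of
   M_(a + n * g_S), standing for the fraction  f S / (x^(g_S))^n  in
   (M_{x^{g_S}})_a, where g_S = \sum_(l in S) gens l.  Cochains of
   cohomological degree i are the components with #|S| = i. *)

Definition gsum (d k : nat) (gens : 'I_k -> 'rV[int]_d) (S : {set 'I_k}) :
  'rV[int]_d := \sum_(l in S) gens l.

Definition shift (d k : nat) (gens : 'I_k -> 'rV[int]_d) (a : 'rV[int]_d)
  (n : nat) (S : {set 'I_k}) : 'rV[int]_d := a + gsum gens S *+ n.

Section Cech.
Variables (K : fieldType) (d k : nat) (gens : 'I_k -> 'rV[int]_d)
  (M : 'rV[int]_d -> lmodType K) (act : forall a b, {linear M a -> M b}).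

Local Notation sh := (shift gens).

Definition cech_d (a : 'rV[int]_d) (n : nat) (f : forall S, M (sh a n S))
  (T : {set 'I_k}) : M (sh a n T) :=
  \sum_(j in T) ((-1 : K) ^+ #|[set j' in T | (j' < j)%N]|) *:
      act (sh a n (T :\ j)) (sh a n T) (f (T :\ j)).

Definition lift (a : 'rV[int]_d) (n N : nat) (f : forall S, M (sh a n S)) :
  forall S, M (sh a N S) :=
  fun S => act (sh a n S) (sh a N S) (f S).

Definition is_cocycle (i : nat) (a : 'rV[int]_d) (n : nat)
  (f : forall S, M (sh a n S)) : Prop :=
  forall T : {set 'I_k}, #|T| = i.+1 ->
    exists N, (n <= N)%N /\ act (sh a n T) (sh a N T) (cech_d f T) = 0.

Definition is_coboundary (i : nat) (a : 'rV[int]_d) (n : nat)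
  (f : forall S, M (sh a n S)) : Prop :=
  exists (n' : nat) (g : forall S, M (sh a n' S)),
    forall S : {set 'I_k}, #|S| = i ->
      exists N, [/\ (n <= N)%N, (n' <= N)%N &
        act (sh a n S) (sh a N S) (f S) = act (sh a n' S) (sh a N S) (cech_d g S)].

Definition H_vanishes (i : nat) (a : 'rV[int]_d) : Prop :=
  forall n f, @is_cocycle i a n f -> @is_coboundary i a n f.

Definition H_findim (i : nat) (a : 'rV[int]_d) : Prop :=
  exists (p n0 : nat) (b : 'I_p -> forall S, M (sh a n0 S)),
    (forall l, is_cocycle i (b l)) /\
    forall n f, @is_cocycle i a n f ->
      exists (coef : 'I_p -> K) (N : nat), [/\ (n <= N)%N, (n0 <= N)%N &
        is_coboundary i (fun S => lift N f S - \sum_(l < p) coef l *: lift N (b l) S)].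

(* H^i_m(M) has finite length (= finite K-dimension, as R/m = K):
   finitely many nonzero graded pieces, each finite dimensional. *)
Definition H_finite_length (i : nat) : Prop :=
  exists D : seq 'rV[int]_d,
    (forall a, a \notin D -> H_vanishes i a) /\ (forall a, H_findim i a).

End Cech.

(* Main.v *)
Require Import Defs.
From HB Require Import structures.
From mathcomp Require Import all_boot all_order all_algebra.
From mathcomp Require Import boolp.
From mathcomp Require Import ring lra zify.
Set Implicit Arguments. Unset Strict Implicit. Unset Printing Implicit Defensive.
Import Order.TTheory GRing.Theory Num.Theory.
Local Open Scope ring_scope.

(* Multiplication by x_l^n is null-homotopic on the Koszul complex of the n-th
   powers, so Cech cohomology is x_l-power torsion. If x_l is regular on a
   module M whose quotient M / x_l M has vanishing cohomology in the degrees
   a + q g_l (q > 0), then x_l is injective on cohomology there, and torsion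
   forces vanishing in degree a. Devissage over the subquotients of M, with
   noetherianity coming from Dickson's lemma and the bound on the dimensions of
   the graded pieces, then gives a finite set D with H_a <> 0 only for a in
   D - C. A degree e - c outside Psi has bounded coefficients in c, since a large
   coefficient of g_l makes h_j(c - e) positive wherever h_j(g_l) > 0; hence only
   finitely many degrees survive. Conversely, if supp_+(c) is contained in
   supp_+(-a), then x^c acts invertibly, in degrees a - qc, on every nonzero
   localisation of the Cech complex in degree a, so the cohomology in degree a
   repeats in all degrees a - qc. *)

(** * Arithmetic in the semigroup and the degrees of Cech cochains *)

Section Semigroup.
Variables (d k : nat) (gens : 'I_k -> 'rV[int]_d).
Local Notation C := (inC gens).
Local Notation sh := (shift gens).

Lemma inC0 : C 0.
Proof. by exists (fun=> 0%N); rewrite big1. Qed.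

Lemma inCD a b : C a -> C b -> C (a + b).
Proof.
move=> [m ->] [m' ->]; exists (fun l => m l + m' l)%N.
by rewrite -big_split; apply: eq_bigr => l _; rewrite mulrnDr.
Qed.

Lemma inC_gen l : C (gens l).
Proof.
exists (fun i => (i == l)%N); rewrite (bigD1 l) //= eqxx big1 ?addr0 //.
by move=> i /negPf->.
Qed.

Lemma inC_sum (I : finType) (P : pred I) F :
  (forall x, P x -> C (F x)) -> C (\sum_(x | P x) F x).
Proof. by move=> H; elim/big_ind: _ => //; [exact: inC0|exact: inCD]. Qed.

Lemma inCMn a n : C a -> C (a *+ n).
Proof.
by move=> Ca; elim: n => [|n IH]; [exact: inC0 | rewrite mulrS; exact: inCD].
Qed.

Lemma inC_gsum S : C (gsum gens S).
Proof. by apply: inC_sum => l _; apply: inC_gen. Qed.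

Lemma inC_sub_trans b a c : C (b - a) -> C (c - b) -> C (c - a).
Proof. by move=> ab bc; rewrite -(subrK b c) -addrA; apply: inCD. Qed.

Lemma shiftB a n m S : (n <= m)%N -> sh a m S - sh a n S = gsum gens S *+ (m - n).
Proof. by move=> nm; rewrite /shift opprD addrACA subrr add0r mulrnBr. Qed.

Lemma inC_shift a n m S : (n <= m)%N -> C (sh a m S - sh a n S).
Proof. by move=> nm; rewrite shiftB //; apply/inCMn/inC_gsum. Qed.

Lemma gsumD1 j (T : {set _}) : j \in T -> gsum gens T = gens j + gsum gens (T :\ j).
Proof. by move=> jT; rewrite /gsum (big_setD1 j). Qed.

Lemma inC_shiftD1 a n j (T : {set _}) : j \in T -> C (sh a n T - sh a n (T :\ j)).
Proof.
move=> jT; rewrite /shift opprD addrACA subrr add0r (gsumD1 jT) mulrnDl addrK.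
exact/inCMn/inC_gen.
Qed.

Lemma shiftD1 a n j (T : {set _}) : j \in T -> sh a n T = sh (a + gens j *+ n) n (T :\ j).
Proof. by move=> jT; rewrite /shift (gsumD1 jT) mulrnDl addrA. Qed.

Lemma shift_addl a w n S : sh (a + w) n S - sh a n S = w.
Proof. by rewrite /shift opprD addrACA subrr addr0 [a + w]addrC addrK. Qed.
End Semigroup.

(** * Signs of the Cech differential *)

Section CechSigns.
Variables (K : fieldType) (k : nat).
Implicit Types (j l : 'I_k) (T : {set 'I_k}).

Definition cech_sign j T : K := (-1) ^+ #|[set j' in T | (j' < j)%N]|.

Lemma cech_sign_sq j T : cech_sign j T * cech_sign j T = 1.
Proof. by rewrite /cech_sign -expr2 sqrr_sign. Qed.

Lemma cech_signD1 j l T : l \in T ->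
  cech_sign j (T :\ l) = cech_sign j T * (-1) ^+ (l < j)%N.
Proof.
move=> lT; rewrite /cech_sign (cardsD1 l [set j' in T | _]) !inE lT /=.
have -> : [set j' in T | (j' < j)%N] :\ l = [set j' in T :\ l | (j' < j)%N].
  by apply/setP => x; rewrite !inE andbA.
by rewrite exprD mulrAC -expr2 sqrr_sign mul1r.
Qed.

(** Removing l from T changes the sign of j exactly when l < j, and exactly one of l < j and j < l
    holds. *)
Lemma cech_sign_swap j l T : j \in T -> l \in T -> j != l ->
  cech_sign j T * cech_sign l (T :\ j) = - (cech_sign l T * cech_sign j (T :\ l)).
Proof.
move=> jT lT jl; rewrite !cech_signD1 //.
have -> : (j < l)%N = ~~ (l < j)%N.
  by rewrite -leqNgt [RHS]leq_eqVlt (inj_eq val_inj) (negPf jl).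
by case: (l < j)%N => /=; rewrite ?expr0 ?expr1; ring.
Qed.
End CechSigns.

(** * The Cech differential and the Koszul homotopy *)

Section CechComplex.
Variables (K : fieldType) (d k : nat) (gens : 'I_k -> 'rV[int]_d)
  (M : 'rV[int]_d -> lmodType K) (act : forall a b, {linear M a -> M b})
  (HM : graded_module gens act).
Local Notation C := (inC gens).
Local Notation sh := (shift gens).
Implicit Types T S U : {set 'I_k}.

Lemma act_id a (v : M a) : act a a v = v.
Proof. by case: HM. Qed.

Lemma act_comp a b c (v : M a) : C (b - a) -> C (c - b) ->
  act b c (act a b v) = act a c v.
Proof. by case: HM => _; apply. Qed.

Lemma cech_dE a n (f : forall S, M (sh a n S)) T :
  cech_d act f T = \sum_(j in T) cech_sign K j T *:
    act (sh a n (T :\ j)) (sh a n T) (f (T :\ j)).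
Proof. by []. Qed.

(** Compatibility is asked face by face, because in [H_vanishes_shift] the difference of the degrees
    lies in C only on some faces. *)
Lemma cech_d_act a n b m (f : forall S, M (sh a n S)) (g : forall S, M (sh b m S)) T :
  (forall j, j \in T -> act (sh b m (T :\ j)) (sh b m T) (g (T :\ j)) =
     act (sh a n T) (sh b m T) (act (sh a n (T :\ j)) (sh a n T) (f (T :\ j)))) ->
  cech_d act g T = act (sh a n T) (sh b m T) (cech_d act f T).
Proof.
move=> H; rewrite !cech_dE linear_sum; apply: eq_bigr => j jT.
by rewrite linearZ H.
Qed.

Lemma cech_d_mul a n b m (f : forall S, M (sh a n S)) T :
  (forall S, C (sh b m S - sh a n S)) ->
  cech_d act (fun S => act (sh a n S) (sh b m S) (f S)) T =
  act (sh a n T) (sh b m T) (cech_d act f T).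
Proof.
move=> H; apply: cech_d_act => j jT.
by rewrite !act_comp //; apply: inC_shiftD1.
Qed.

Lemma cech_d_linear a n (x : K) (f g : forall S, M (sh a n S)) T :
  cech_d act (fun S => x *: f S + g S) T = x *: cech_d act f T + cech_d act g T.
Proof.
rewrite !cech_dE scaler_sumr -big_split; apply: eq_bigr => j jT.
by rewrite linearP scalerDr !scalerA mulrC.
Qed.

Lemma cech_dD a n (f g : forall S, M (sh a n S)) T :
  cech_d act (fun S => f S + g S) T = cech_d act f T + cech_d act g T.
Proof.
rewrite -[cech_d act f T]scale1r -cech_d_linear.
by rewrite !cech_dE; apply: eq_bigr => j jT; rewrite scale1r.
Qed.

Lemma cech_dB a n (f g : forall S, M (sh a n S)) T :
  cech_d act (fun S => f S - g S) T = cech_d act f T - cech_d act g T.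
Proof.
rewrite !cech_dE -sumrB; apply: eq_bigr => j jT.
by rewrite linearB scalerBr.
Qed.

Lemma cech_d_lift a n N (f : forall S, M (sh a n S)) T : (n <= N)%N ->
  cech_d act (Defs.lift act N f) T = act (sh a n T) (sh a N T) (cech_d act f T).
Proof. by move=> nN; apply: cech_d_mul => S; apply: inC_shift. Qed.

Lemma cech_d_eq a n i (f g : forall S, M (sh a n S)) T : #|T| = i.+1 ->
  (forall S, #|S| = i -> f S = g S) -> cech_d act f T = cech_d act g T.
Proof.
move=> cT H; rewrite !cech_dE; apply: eq_bigr => j jT.
by rewrite H //; move: cT; rewrite (cardsD1 j) jT => -[].
Qed.

Lemma cech_dd a n (f : forall S, M (sh a n S)) T :
  cech_d act (cech_d act f) T = 0.
Proof.
pose phi U := act (sh a n U) (sh a n T) (f U).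
pose F j l := (cech_sign K j T * cech_sign K l (T :\ j)) *: phi (T :\ j :\ l).
have -> : cech_d act (cech_d act f) T =
    \sum_(j in T) \sum_(l in T | l != j) F j l.
  rewrite cech_dE; apply: eq_bigr => j jT.
  rewrite cech_dE linear_sum scaler_sumr.
  apply: eq_big => l; first by rewrite !inE andbC.
  rewrite !inE => /andP[lj lT]; rewrite linearZ scalerA act_comp //.
    by apply: inC_shiftD1; rewrite !inE lj.
  exact: inC_shiftD1.
(* The ordered pairs are split into l < j and j < l. Exchanging the sums matches (j, l) with (l, j),
   whose terms have opposite signs. *)
have split_lt j : j \in T -> \sum_(l in T | l != j) F j l =
    \sum_(l in T | (l < j)%N) F j l + \sum_(l in T | (j < l)%N) F j l.
  move=> jT; rewrite (bigID (fun l : 'I_k => (l < j)%N)) /=.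
  congr (_ + _); apply: eq_bigl => l; rewrite -val_eqE /=; lia.
rewrite (eq_bigr _ split_lt) big_split /=.
rewrite [X in X + _](exchange_big_dep (mem T)) /=; last first.
  by move=> j l _ /andP[].
rewrite -big_split big1 //= => l lT.
rewrite (eq_bigl (fun j : 'I_k => (j \in T) && (l < j)%N)); last first.
  by move=> j; rewrite lT.
rewrite -big_split big1 //= => j /andP[jT jl].
have jnl : j != l by rewrite -val_eqE /=; lia.
by rewrite /F cech_sign_swap // scaleNr setDDl setUC -setDDl addNr.
Qed.

(* The contraction of the Koszul complex on the powers x_l ^ n that makes
   multiplication by x_l ^ n null-homotopic. *)
Definition cech_contract l a n (f : forall S, M (sh a n S)) S :
  M (sh (a + gens l *+ n) n S) :=
  if l \in S then 0 else cech_sign K l (l |: S) *: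
    act (sh a n (l |: S)) (sh (a + gens l *+ n) n S) (f (l |: S)).

(** If l lies in T, only the face [T :\ l] contributes, and the sign squares to 1. Otherwise the
    face T of [l |: T] gives f T, and the remaining terms of the two summands cancel in pairs. *)
Lemma cech_homotopy l a n (f : forall S, M (sh a n S)) T :
  act (sh a n T) (sh (a + gens l *+ n) n T) (f T) =
  cech_d act (cech_contract l f) T + cech_contract l (cech_d act f) T.
Proof.
pose phi U := act (sh a n U) (sh (a + gens l *+ n) n T) (f U).
have CU U S : l \notin S -> U = l |: S -> C (sh (a + gens l *+ n) n S - sh a n U).
  move=> lS ->; rewrite (@shiftD1 _ _ _ a n l) ?setU11 //.
  by rewrite setU1K // subrr; apply: inC0.
case: (boolP (l \in T)) => lT.
  rewrite {2}/cech_contract lT addr0 cech_dE (bigD1 l) //= big1 ?addr0.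
    rewrite /cech_contract setD11 setD1K //.
    rewrite linearZ scalerA cech_sign_sq scale1r act_comp //.
      by apply: CU; rewrite ?setD11 ?setD1K.
    exact: inC_shiftD1.
  move=> j /andP[jT jl]; rewrite /cech_contract !inE lT eq_sym jl /=.
  by rewrite linear0 scaler0.
rewrite {2}/cech_contract (negPf lT) [cech_d act f _]cech_dE (bigD1 l) ?setU11 //= setU1K //.
rewrite linearD scalerDr linearZ scalerA cech_sign_sq scale1r.
rewrite act_comp; last 2 first.
- by rewrite -{2}(setU1K lT); apply: inC_shiftD1; rewrite setU11.
- exact: CU.
rewrite addrCA cech_dE linear_sum scaler_sumr.
rewrite [X in _ + (_ + X)](eq_bigl (mem T)); last first.
  move=> j; rewrite !inE andb_orl; case: (j =P l) => [->|_] /=.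
    by rewrite (negPf lT).
  by rewrite andbT.
rewrite -big_split big1 ?addr0 //= => j jT.
have jl : j != l by apply: contraNneq lT => <-.
have e : (l |: T) :\ j = l |: (T :\ j).
  by apply/setP=> x; rewrite !inE; case: (x =P l) => // ->; rewrite eq_sym jl.
rewrite /cech_contract !inE (negPf lT) andbF.
rewrite [X in _ *: X + _]linearZ_LR.
rewrite [X in _ + _ *: X]linearZ_LR.
rewrite [X in X + _ = 0]scalerA.
rewrite [X in _ + X = 0]scalerA.
have -> : act (sh (a + gens l *+ n) n (T :\ j)) (sh (a + gens l *+ n) n T) (act (sh a n (l |: T :\ j))
    (sh (a + gens l *+ n) n (T :\ j)) (f (l |: T :\ j))) = phi ((l |: T) :\ j).
  rewrite e act_comp //; last exact: inC_shiftD1.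
  by apply: CU; rewrite // !inE (negPf lT) andbF.
have -> : act (sh a n (l |: T)) (sh (a + gens l *+ n) n T) (act (sh a n ((l |: T) :\ j))
    (sh a n (l |: T)) (f ((l |: T) :\ j))) = phi ((l |: T) :\ j).
  rewrite act_comp //; last exact: CU.
  by apply: inC_shiftD1; rewrite !inE jT orbT.
rewrite -scalerDl -e.
have lT' : l \in l |: T by apply: setU11.
have jT' : j \in l |: T by rewrite !inE jT orbT.
have -> : cech_sign K j T = cech_sign K j ((l |: T) :\ l) by rewrite setU1K.
rewrite [X in X *: _ = 0](_ : _ = 0) ?scale0r //.
rewrite !cech_signD1 //.
rewrite (_ : (l < j)%N = ~~ (j < l)%N); last first.
  by rewrite -leqNgt [RHS]leq_eqVlt eq_sym (inj_eq val_inj) (negPf jl).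
by case: (j < l)%N => /=; rewrite ?expr0 ?expr1; ring.
Qed.
End CechComplex.

(** * Cohomology of subquotients and descent along a regular variable *)

Section RelativeCohomology.
Variables (K : fieldType) (d k : nat) (gens : 'I_k -> 'rV[int]_d)
  (M : 'rV[int]_d -> lmodType K) (act : forall a b, {linear M a -> M b})
  (HM : graded_module gens act).
Local Notation C := (inC gens).
Local Notation sh := (shift gens).
Implicit Types (T S U : {set 'I_k}) (L N P : forall a, M a -> Prop).

(** Submodules are families of predicates on the graded pieces, so that all of them share the
    multiplication maps of M. *)
Definition graded_submod N :=
  [/\ forall a, N a 0,
      forall a (x : K) (u v : M a), N a u -> N a v -> N a (x *: u + v) &
      forall a b (v : M a), C (b - a) -> N a v -> N b (act a b v)].

Definition submod_le N L := forall a (v : M a), N a v -> L a v.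

Section SubmodTheory.
Variable N : forall a, M a -> Prop.
Hypothesis sN : graded_submod N.

Lemma submod0 a : N (0 : M a). Proof. by case: sN. Qed.

Lemma submod_act a b (v : M a) : C (b - a) -> N v -> N (act a b v).
Proof. by case: sN => _ _; apply. Qed.

Lemma submodD a (u v : M a) : N u -> N v -> N (u + v).
Proof. by case: sN => _ H _ Nu Nv; rewrite -[u]scale1r; apply: H. Qed.

Lemma submodZ a x (u : M a) : N u -> N (x *: u).
Proof. by case: sN => N0 H _ Nu; rewrite -[_ *: u]addr0; apply: H. Qed.

Lemma submodN a (u : M a) : N u -> N (- u).
Proof. by rewrite -scaleN1r; apply: submodZ. Qed.

Lemma submodB a (u v : M a) : N u -> N v -> N (u - v).
Proof. by move=> Nu Nv; apply: submodD => //; apply: submodN. Qed.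

Lemma submod_sum a (I : finType) (Q : pred I) (F : I -> M a) :
  (forall x, Q x -> N (F x)) -> N (\sum_(x | Q x) F x).
Proof.
by move=> H; elim/big_ind: _ => //; [apply: submod0|move=> *; apply: submodD].
Qed.

Lemma submod_cech_d a n (f : forall S, M (sh a n S)) T :
  (forall j, j \in T -> N (f (T :\ j))) -> N (cech_d act f T).
Proof.
move=> H; rewrite cech_dE; apply: submod_sum => j jT.
by apply/submodZ/submod_act; [exact: inC_shiftD1|exact: H].
Qed.
End SubmodTheory.

(* Vanishing of the i-th cohomology of L / N in degree a. Cochains of L / N are
   cochains of L read modulo N, so that no quotient module is formed. *)
Definition Van L N i a := forall n (f : forall S, M (sh a n S)),
  (forall S, L _ (f S)) ->
  (forall T, #|T| = i.+1 -> N _ (cech_d act f T)) ->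
  exists m (g : forall S, M (sh a m S)), [/\ (n <= m)%N, forall S, L _ (g S) &
    forall S, #|S| = i ->
      N _ (act (sh a n S) (sh a m S) (f S) - cech_d act g S)].

(** Exactness in the middle of the cohomology of 0 -> N/P -> L/P -> L/N -> 0: subtracting a
    coboundary moves the cocycle into N, where it bounds modulo P. *)
Lemma Van_ext P N L i a : graded_submod P -> graded_submod N -> graded_submod L ->
  submod_le P N -> submod_le N L -> Van L N i a -> Van N P i a -> Van L P i a.
Proof.
move=> sP sN sL PN NL vLN vNP n f Lf df.
have [m [g [nm Lg fg]]] := vLN n f Lf (fun T cT => PN _ _ (df T cT)).
(* Membership in N is known on faces of size i only, so the corrected cochain is zero elsewhere. The
   differential on faces of size i+1 does not see the change. *)
pose f' S : M (sh a m S) := if #|S| == i then Defs.lift act m f S - cech_d act g S else 0.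
have Nf' S : N _ (f' S).
  by rewrite /f'; case: eqP => [/fg//|_]; apply: submod0.
have df' T : #|T| = i.+1 -> P _ (cech_d act f' T).
  move=> cT; rewrite (@cech_d_eq _ _ _ _ _ act a m i _
    (fun S => Defs.lift act m f S - cech_d act g S)) //.
    rewrite cech_dB // (cech_dd HM) subr0 (cech_d_lift HM) //.
    by apply: submod_act => //; [apply: inC_shift | apply: df].
  by move=> S cS; rewrite /f' cS eqxx.
have [m' [g' [mm' Ng' fg']]] := vNP m f' Nf' df'.
exists m', (fun S => act (sh a m S) (sh a m' S) (g S) + g' S); split.
- exact: leq_trans mm'.
- move=> S; apply: submodD => //; last exact: NL.
  by apply: submod_act => //; apply: inC_shift.
- move=> S cS; have := fg' S cS; rewrite /f' cS eqxx linearB.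
  rewrite cech_dD // (@cech_d_mul _ _ _ _ _ act HM a m); last first.
    by move=> *; apply: inC_shift.
  rewrite /Defs.lift (act_comp HM); try exact: inC_shift.
  by rewrite opprD addrA.
Qed.

Definition mul_submod l L : forall b, M b -> Prop :=
  fun b v => exists2 w : M (b - gens l), L _ w & v = act _ b w.

Definition add_submod N L : forall b, M b -> Prop :=
  fun b v => exists u w, [/\ N b u, L b w & v = u + w].

Lemma inC_subgen l b : C (b - (b - gens l)).
Proof. by rewrite opprB addrC subrK; apply: inC_gen. Qed.

Lemma submod_add_mul l N L : graded_submod N -> graded_submod L ->
  graded_submod (add_submod N (mul_submod l L)).
Proof.
move=> sN sL; split.
- move=> a; exists 0, 0; split; rewrite ?addr0 //; first exact: submod0.
  by exists 0; rewrite ?linear0 //; apply: submod0.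
- move=> a x u v [u1 [_ [Nu1 [w Lw ->] ->]]] [v1 [_ [Nv1 [w' Lw' ->] ->]]].
  exists (x *: u1 + v1), (act (a - gens l) a (x *: w + w')); split.
  + by case: sN => _ H _; apply: H.
  + by exists (x *: w + w') => //; case: sL => _ H _; apply: H.
  + by rewrite linearP scalerDr addrACA.
- move=> a b v Cab [u [_ [Nu [w Lw ->] ->]]].
  have Cs : C (b - gens l - (a - gens l)).
    by rewrite opprB addrA subrK.
  exists (act a b u), (act _ b (act (a - gens l) (b - gens l) w)); split.
  + exact: submod_act.
  + by eexists; last reflexivity; apply: submod_act.
  + rewrite linearD !(act_comp HM) //; exact: inC_subgen.
Qed.

Lemma cech_d_const0 b m T : cech_d act (fun S => 0 : M (sh b m S)) T = 0.
Proof. by rewrite cech_dE big1 // => j _; rewrite linear0 scaler0. Qed.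

(** The target degree is a variable tied to b by an equation, so that any expression equal to
    [b + gens l] fits without a cast. *)
Definition nzd_mod l N L := forall (b c : 'rV[int]_d) (v : M b),
  c = b + gens l -> L b v -> N c (act b c v) -> N b v.

(** The long exact sequence of multiplication by x_l, on cochains. If x_l f = d g modulo N, then g
    is a cocycle modulo N + x_l L, so g = d g' + x_l g'' modulo N. Hence x_l (f - d g'') lies in N,
    and x_l cancels. *)
Lemma nzd_descent l N L i (b c : 'rV[int]_d) n (f : forall S, M (sh b n S)) :
  graded_submod N -> graded_submod L -> submod_le N L -> nzd_mod l N L ->
  c = b + gens l ->
  (forall j, Van L (add_submod N (mul_submod l L)) j c) ->
  (forall S, L _ (f S)) ->
  (exists m (g : forall S, M (sh c m S)), [/\ (n <= m)%N, forall S, L _ (g S) &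
     forall S, #|S| = i -> N _ (act (sh b n S) (sh c m S) (f S) - cech_d act g S)]) ->
  exists m (g : forall S, M (sh b m S)), [/\ (n <= m)%N, forall S, L _ (g S) &
     forall S, #|S| = i -> N _ (act (sh b n S) (sh b m S) (f S) - cech_d act g S)].
Proof.
move=> sN sL NL nzd cb vQ Lf [m [g [nm Lg fg]]].
have shc r S : sh c r S = sh b r S + gens l by rewrite cb /shift addrAC.
have Cbc r S : C (sh c r S - sh b r S).
  by rewrite shc addrAC subrr add0r; apply: inC_gen.
have Cnc r S : (n <= r)%N -> C (sh c r S - sh b n S).
  by move=> nr; apply: (inC_sub_trans (inC_shift gens b S nr)).
(* For i = 0 the term d g is an empty sum, so x_l f lies in N and x_l cancels at once. *)
case: i fg => [|i] fg.
  exists m, (fun S => 0); split=> // [S|S cS]; first exact: submod0.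
  rewrite cech_d_const0 subr0; apply: (nzd _ (sh c m S) _ (shc m S)).
    by apply: (submod_act sL); [exact: inC_shift|].
  rewrite (act_comp HM) //; last exact: inC_shift.
  have := fg S cS; rewrite [cech_d _ _ _]big1 ?subr0 // => j.
  by rewrite (cards0_eq cS) inE.
have dg T : #|T| = i.+1 -> add_submod N (mul_submod l L) (cech_d act g T).
  move=> cT; have NT := fg T cT.
  exists (- (act (sh b n T) (sh c m T) (f T) - cech_d act g T)),
    (act (sh b n T) (sh c m T) (f T)); split; first exact: submodN.
    have e : sh c m T - gens l = sh b m T by rewrite shc addrK.
    exists (act (sh b n T) (sh c m T - gens l) (f T)).
      by apply: (submod_act sL) => //; rewrite e; apply: inC_shift.
    rewrite (act_comp HM) //; last exact: inC_subgen.
    by rewrite e; apply: inC_shift.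
  by rewrite opprB subrK.
have [m' [g' [mm' Lg' gg']]] := vQ i m g Lg dg.
have nm' : (n <= m')%N by apply: leq_trans mm'.
(* The quotient of g - d g' by x_l modulo N, chosen face by face, with the default 0 outside the
   faces of size i. *)
have H S : exists w : M (sh b m' S), L _ w /\ (#|S| = i ->
    N _ (act (sh c m S) (sh c m' S) (g S) - cech_d act g' S
         - act (sh b m' S) (sh c m' S) w)).
  case: (eqVneq #|S| i) => [cS|ncS]; last first.
    by exists 0; split; [exact: submod0|move=> e; rewrite e eqxx in ncS].
  have [u [_ [Nu [w Lw ->] ->]]] := gg' S cS.
  have e : sh b m' S - (sh c m' S - gens l) = 0.
    by rewrite shc addrK subrr.
  have C0 : C (sh b m' S - (sh c m' S - gens l)) by rewrite e; apply: inC0.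
  exists (act _ (sh b m' S) w); split; first exact: (submod_act sL).
  by rewrite (act_comp HM) // addrK.
pose g'' S := projT1 (cid (H S)).
have Lg'' S : L _ (g'' S) by rewrite /g''; case: (cid (H S)) => /= ? [].
have Ng'' S : #|S| = i -> N _ (act (sh c m S) (sh c m' S) (g S) - cech_d act g' S
         - act (sh b m' S) (sh c m' S) (g'' S)).
  by rewrite /g''; case: (cid (H S)) => /= ? [].
exists m', g''; split=> // S cS.
apply: (nzd _ (sh c m' S) _ (shc m' S)).
  apply: (submodB sL); first by apply: (submod_act sL); [exact: inC_shift|].
  by apply: (submod_cech_d sL) => j jS.
rewrite linearB (act_comp HM) //; last exact: inC_shift.
rewrite -(cech_d_mul HM g'') //.
(* At the raised exponent, x_l (f - d g'') is (x_l f - d g) + d (g - d g' - x_l g''), by d d = 0.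
   Both summands lie in N. *)
have -> : act (sh b n S) (sh c m' S) (f S) -
    cech_d act (fun S => act (sh b m' S) (sh c m' S) (g'' S)) S =
  act (sh c m S) (sh c m' S) (act (sh b n S) (sh c m S) (f S) - cech_d act g S) +
  cech_d act (fun S => act (sh c m S) (sh c m' S) (g S) - cech_d act g' S
     - act (sh b m' S) (sh c m' S) (g'' S)) S.
  rewrite linearB (act_comp HM) //; [|exact: Cnc|exact: inC_shift].
  rewrite cech_dB [X in _ + (X - _)]cech_dB (cech_dd HM) subr0.
  rewrite (cech_d_mul HM g); last by move=> U; apply: inC_shift.
  by rewrite addrA subrK.
apply: (submodD sN).
  by apply: (submod_act sN); [exact: inC_shift|exact: fg].
apply: (submod_cech_d sN) => j jS; apply: Ng''.
by move: cS; rewrite (cardsD1 j) jS => -[].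
Qed.

(* Every Cech class is killed by a power of x_l, and the vanishing of the
   cohomology of L / (N + x_l L) makes multiplication by x_l injective. *)
Lemma Van_nzd l N L i (a : 'rV[int]_d) :
  graded_submod N -> graded_submod L -> submod_le N L -> nzd_mod l N L ->
  (forall q j, Van L (add_submod N (mul_submod l L)) j (a + gens l *+ q.+1)) ->
  Van L N i a.
Proof.
move=> sN sL NL nzd vQ n f Lf df.
(* [cob q] says that x_l^q f is a coboundary modulo N. It holds for q = n, the exponent of f, by the
   homotopy, and descends to q = 0. *)
pose cob q := exists m (g : forall S, M (sh (a + gens l *+ q) m S)),
  [/\ (n <= m)%N, forall S, L _ (g S) & forall S, #|S| = i ->
   N _ (act (sh a n S) (sh (a + gens l *+ q) m S) (f S) - cech_d act g S)].
have Cq q S : C (sh (a + gens l *+ q) n S - sh a n S).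
  by rewrite shift_addl; apply/inCMn/inC_gen.
have CU S : l \notin S -> C (sh (a + gens l *+ n) n S - sh a n (l |: S)).
  move=> lS; rewrite (@shiftD1 _ _ _ a n l (l |: S)) ?setU11 // setU1K // subrr.
  exact: inC0.
have cobn : cob n.
  exists n, (cech_contract act l f); split=> //.
    move=> S; rewrite /cech_contract; case: ifPn => lS; first exact: submod0.
    by apply: (submodZ sL); apply: (submod_act sL); first exact: CU.
  move=> S cS; rewrite (cech_homotopy HM) [cech_d _ _ _ + _]addrC addrK.
  rewrite /cech_contract; case: ifPn => lS; first exact: submod0.
  apply: (submodZ sN); apply: (submod_act sN); first exact: CU.
  by apply: df; rewrite cardsU1 lS cS.
have step q : cob q.+1 -> cob q.
  move=> [m [g [nm Lg fg]]].
  have Cm S : C (sh (a + gens l *+ q.+1) m S - sh (a + gens l *+ q) n S).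
    apply: (inC_sub_trans (inC_shift gens _ S nm)).
    by rewrite mulrSr addrA shift_addl; apply: inC_gen.
  pose f' S := act (sh a n S) (sh (a + gens l *+ q) n S) (f S).
  have Lf' S : L _ (f' S) by apply: (submod_act sL).
  have [||m' [g' [nm' Lg' fg']]] := @nzd_descent l N L i (a + gens l *+ q)
    (a + gens l *+ q.+1) n f' sN sL NL nzd _ (vQ q) Lf'.
  - by rewrite mulrSr addrA.
  - exists m, g; split=> // S cS; rewrite (act_comp HM) //; exact: fg.
  exists m', g'; split=> // S cS; have := fg' S cS.
  by rewrite (act_comp HM) //; apply: inC_shift.
have : cob 0%N by elim: (n) cobn => // q IH /step.
by rewrite /cob mulr0n addr0.
Qed.
End RelativeCohomology.

(** * Dickson's lemma *)

Lemma nondecreasing_subseq (u : nat -> nat) : exists phi : nat -> nat,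
  (forall i, phi i < phi i.+1)%N /\ (forall i, u (phi i) <= u (phi i.+1))%N.
Proof.
(* An index where u is minimal on the tail from n. Choosing such indices successively gives the
   subsequence. *)
have H n : exists i, (n <= i)%N /\ forall j, (n <= j)%N -> (u i <= u j)%N.
  have ex : exists x, `[< exists2 i, (n <= i)%N & u i = x >].
    by exists (u n); apply/asboolP; exists n.
  case: (ex_minnP ex) => x /asboolP[i ni ui] mx; exists i; split=> // j nj.
  by rewrite ui mx //; apply/asboolP; exists j.
have [f fP] := choice H.
pose phi i := iter i (fun x => f x.+1) (f 0%N).
exists phi; split=> i; first by rewrite /= (proj1 (fP _)).
have lt : (phi i < phi i.+1)%N by rewrite /= (proj1 (fP _)).
have [x ex] : exists x, phi i = f x by case: (i) => [|j]; eexists; reflexivity.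
rewrite {1}ex; apply: (proj2 (fP x)); apply: leq_trans (ltnW lt).
by rewrite ex (proj1 (fP x)).
Qed.

(** The subsequence is refined one coordinate at a time; passing to a further subsequence keeps the
    coordinates already treated nondecreasing. *)
Lemma dickson (I : finType) (u : I -> nat -> nat) : exists phi : nat -> nat,
  (forall i j, (i < j)%N -> (phi i < phi j)%N) /\
  (forall x i j, (i <= j)%N -> (u x (phi i) <= u x (phi j))%N).
Proof.
suff [phi [inc mono]] : exists phi : nat -> nat,
  (forall i j, (i < j)%N -> (phi i < phi j)%N) /\
  (forall x, x \in enum I -> forall i j, (i <= j)%N -> (u x (phi i) <= u x (phi j))%N).
  by exists phi; split=> // x; apply: mono; rewrite mem_enum.
elim: (enum I) => [|x s [phi [inc mono]]]; first by exists id.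
have [psi [pinc pmono]] := nondecreasing_subseq (u x \o phi).
have pinc' i j : (i < j)%N -> (psi i < psi j)%N.
  exact: (homo_ltn (@ltn_trans) pinc).
exists (phi \o psi); split=> [i j ij|y]; first by apply/inc/pinc'.
rewrite inE => /orP[/eqP->|ys] i j ij.
  exact: (homo_leq (f := u x \o phi \o psi) (@leqnn) (@leq_trans) pmono).
by apply: mono => //; move: ij; rewrite leq_eqVlt => /orP[/eqP->//|/pinc'/ltnW].
Qed.

(** * Ascending chains of subspaces of K^n *)

Section Subspaces.
Variables (K : fieldType) (n : nat).
Implicit Types V : 'rV[K]_n -> Prop.

Definition subspace V :=
  V 0 /\ forall (x : K) u v, V u -> V v -> V (x *: u + v).

(** Take a matrix of maximal rank with row space inside V: a vector of V outside that row space
    would raise the rank. *)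
Lemma subspace_mx V : subspace V ->
  exists A : 'M[K]_n, forall v, V v <-> (v <= A)%MS.
Proof.
move=> [V0 VP].
pose P r := `[< exists2 A : 'M[K]_n, \rank A = r & forall v, (v <= A)%MS -> V v >].
have ex : exists r, P r.
  exists 0%N; apply/asboolP; exists 0; first exact: mxrank0.
  by move=> v; rewrite submx0 => /eqP->.
have ub r : P r -> (r <= n)%N by case/asboolP => A <- _; apply: rank_leq_row.
case: (ex_maxnP ex ub) => r /asboolP[A rA AV] max.
exists A => v; split=> [Vv|]; last exact: AV.
apply: contrapT => /negP vA.
have : P (\rank (A + v)%MS).
  apply/asboolP; exists (A + v)%MS => // w /sub_addsmxP[[x y] ->] /=.
  rewrite addrC (_ : y *m v = y 0 0 *: v).
    by apply: VP => //; apply: AV; apply: submxMl.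
  by rewrite -mul_scalar_mx; congr (_ *m _); apply/rowP => j; rewrite !mxE ord1 eqxx.
move/max; rewrite -rA leqNgt => /negP; apply; apply: rank_ltmx.
by rewrite /ltmx addsmxSl /= addsmx_sub submx_refl.
Qed.

Lemma subspace_acc (V : nat -> 'rV[K]_n -> Prop) :
  (forall i, subspace (V i)) -> (forall i v, V i v -> V i.+1 v) ->
  exists i, forall v, V i.+1 v -> V i v.
Proof.
move=> sV inc; apply: contrapT => /forallNP H.
have [A AP] := choice (fun i => subspace_mx (sV i)).
have lt i : (\rank (A i) < \rank (A i.+1))%N.
  apply: rank_ltmx; rewrite /ltmx; apply/andP; split.
    by apply/row_subP => j; apply/AP/inc/AP/row_sub.
  apply/negP => /row_subP sub; apply: (H i) => v /AP vA; apply/AP.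
  by apply: submx_trans vA _; apply/row_subP.
have ge i : (i <= \rank (A i))%N by elim: i => // i IH; apply: leq_ltn_trans (lt i).
by have := leq_trans (ge n.+1) (rank_leq_row _); rewrite ltnn.
Qed.
End Subspaces.

(** * Noetherianity and subquotients killed by all variables *)

Section Noetherian.
Variables (K : fieldType) (d k : nat) (gens : 'I_k -> 'rV[int]_d)
  (M : 'rV[int]_d -> lmodType K) (act : forall a b, {linear M a -> M b})
  (HM : graded_module gens act) (Hfg : fin_gen gens act).
Local Notation C := (inC gens).
Local Notation sh := (shift gens).
Local Notation submod := (graded_submod gens act).
Implicit Types (T S U : {set 'I_k}) (L N P : forall a, M a -> Prop).

(** An excluded bad sequence, which covers both ascending chains and elements in infinitely many
    degrees. Dickson's lemma gives a subsequence whose degree differences lie in C. Along it, the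
    coefficient vectors of elements of N form an ascending chain in K^p, which must stop. *)
Lemma noetherian (b : nat -> 'rV[int]_d) (v : forall n, M (b n))
  (N : nat -> forall a, M a -> Prop) :
  (forall n, submod (N n)) -> (forall n, submod_le (N n) (N n.+1)) ->
  (forall n, ~ N n _ (v n)) ->
  (forall n m, (n < m)%N -> C (b m - b n) -> N m _ (act (b n) (b m) (v n))) ->
  False.
Proof.
move=> sN inc nNv Nv; have [p [deg [g gP]]] := Hfg.
have incl n m : (n <= m)%N -> submod_le (N n) (N m).
  elim: m => [|m IH]; first by rewrite leqn0 => /eqP->.
  by rewrite leq_eqVlt => /orP[/eqP->//|nm] a w /(IH nm); apply: inc.
have [c cP] := choice (fun n => gP (b n) (v n)).
have ln n : exists l, C (b n - deg l).
  apply: contrapT => /forallNP H; apply: (nNv n).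
  rewrite (proj2 (cP n)) big1 => [|l _]; first exact: submod0.
  by rewrite (proj1 (cP n)) ?scale0r.
have [lam lamP] := choice ln.
have [mu muP] := choice lamP.
(* As [lam n < p], the two coordinates [lam n] and [p - lam n] can both be nondecreasing only if the
   generator index is constant. *)
pose u (x : 'I_k + bool) n : nat := match x with
  | inl l => mu n l | inr true => lam n | inr false => p - lam n end%N.
have [phi [pinc pmono]] := dickson u.
have Cb i j : (i <= j)%N -> C (b (phi j) - b (phi i)).
  move=> ij; have el : lam (phi j) = lam (phi i).
    apply: val_inj => /=; have := pmono (inr true) i j ij.
    have := pmono (inr false) i j ij; rewrite /u.
    have := ltn_ord (lam (phi i)); have := ltn_ord (lam (phi j)); lia.
  rewrite -(subrK (deg (lam (phi i))) (b (phi j))) -{1}el -addrA muP.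
  rewrite -[X in _ + X]opprB muP.
  exists (fun l => mu (phi j) l - mu (phi i) l)%N.
  rewrite -sumrB; apply: eq_bigr => l _; rewrite mulrnBr //.
  exact: (pmono (inl l)).
pose ev i (w : 'rV[K]_p) := \sum_l w 0 l *: act (deg l) (b (phi i)) (g l).
(* Coefficients of generators not below the degree must vanish, as [act] obeys the module axioms
   only along C. *)
pose V i (w : 'rV[K]_p) :=
  (forall l, ~ C (b (phi i) - deg l) -> w 0 l = 0) /\ N (phi i) _ (ev i w).
have [i|i w [w0 Nw]|i iP] := @subspace_acc K p V.
- split; first split=> [l _|]; rewrite ?mxE //.
    by rewrite /ev big1 => [|l _]; [apply: submod0|rewrite mxE scale0r].
  move=> x w w' [w0 Nw] [w0' Nw']; split=> [l nC|].
    by rewrite !mxE w0 // w0' // mulr0 addr0.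
  rewrite /ev (_ : \sum_l _ = x *: ev i w + ev i w').
    by case: (sN (phi i)) => _ H _; apply: H.
  rewrite scaler_sumr -big_split; apply: eq_bigr => l _.
  by rewrite !mxE scalerDl scalerA.
- have w0' l : ~ C (b (phi i.+1) - deg l) -> w 0 l = 0.
    by move=> nC; apply: w0 => Cl; apply/nC/inC_sub_trans/Cb/leqnSn.
  split=> //; rewrite (_ : ev i.+1 w = act _ _ (ev i w)).
    apply: (submod_act (sN _)); first exact/Cb.
    by apply: incl Nw; apply/ltnW/pinc.
  rewrite linear_sum; apply: eq_bigr => l _; rewrite linearZ_LR.
  have [Cl|nCl] := pselect (C (b (phi i) - deg l)); last by rewrite w0 // !scale0r.
  by rewrite (act_comp HM) //; apply: Cb.
(* The coefficients of [v (phi i)] lie in V (i+1) by [Nv], hence in V i. *)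
- apply: (nNv (phi i)).
  pose w := \row_l c (phi i) l.
  have evw : ev i w = v (phi i).
    rewrite (proj2 (cP (phi i))); apply: eq_bigr => l _; rewrite mxE //.
  have : V i.+1 w.
    split=> [l nC|].
      rewrite mxE; apply: (proj1 (cP (phi i))) => Cl; apply: nC.
      by apply: inC_sub_trans Cl _; apply: Cb.
    rewrite (_ : ev i.+1 w = act (b (phi i)) _ (v (phi i))).
      by apply: Nv; [apply: pinc|apply: Cb].
    rewrite -evw linear_sum; apply: eq_bigr => l _; rewrite linearZ_LR.
    have [Cl|nCl] := pselect (C (b (phi i) - deg l)).
      by rewrite (act_comp HM) //; apply: Cb.
    by rewrite mxE (proj1 (cP (phi i))) // !scale0r.
  by move/iP => [_]; rewrite evw.
Qed.

Definition kills l L N := forall (b c : 'rV[int]_d) (v : M b),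
  c = b + gens l -> L b v -> N c (act b c v).

Lemma kills_trans l L N b c (v : M b) : submod N -> kills l L N -> L b v ->
  C (c - (b + gens l)) -> N c (act b c v).
Proof.
move=> sN kl Lv Cc; rewrite -(@act_comp _ _ _ _ _ _ HM b (b + gens l)) //.
  by apply: (submod_act sN) => //; apply: kl.
by rewrite addrAC subrr add0r; apply: inC_gen.
Qed.

Lemma inC_neq0 c : C c -> c != 0 -> exists l, C (c - gens l).
Proof.
move=> [m ->] n0; have [l ml] : exists l, (0 < m l)%N.
  apply: contrapT => /forallNP H; case/eqP: n0; rewrite big1 // => l _.
  by have /negP := H l; rewrite -eqn0Ngt => /eqP->.
exists l, (fun j => m j - (j == l))%N.
rewrite (bigD1 l) //= [RHS](bigD1 l) //= eqxx addrAC; congr (_ + _).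
  by rewrite mulrnBr.
by apply: eq_bigr => j /negPf->; rewrite subn0.
Qed.

(** Otherwise there are elements of L outside N in infinitely many distinct degrees. If two of these
    differ by an element of C, it is nonzero, so some x_l divides the multiplier and sends the first
    element into N. This is a bad sequence for the constant chain N. *)
Lemma killed_finite L N : submod L -> submod N -> (forall l, kills l L N) ->
  exists D : seq 'rV[int]_d, forall b (v : M b), b \notin D -> L b v -> N b v.
Proof.
move=> sL sN kl; apply: contrapT => /forallNP H.
have H' (D : seq 'rV[int]_d) : exists b : 'rV[int]_d, b \notin D /\ exists v : M b, L b v /\ ~ N b v.
  apply: contrapT => /forallNP H'; apply: (H D) => b v bD Lv.
  by apply: contrapT => nN; apply: (H' b); split=> //; exists v.
have [F FP] := choice H'.
(* [Ds n] lists the degrees chosen before stage n, so each new degree avoids them. *)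
pose Ds n := iter n (fun D => F D :: D) [::].
pose b n := F (Ds n).
have vP n : exists v : M (b n), L _ v /\ ~ N _ v by case: (FP (Ds n)).
pose v n := projT1 (cid (vP n)).
have Lv n : L _ (v n) by rewrite /v; case: (cid _) => ? [].
have Nv n : ~ N _ (v n) by rewrite /v; case: (cid _) => ? [].
apply: (@noetherian b v (fun=> N)) => // [n a w //|n m nm Cb].
have bD : b n \in Ds m.
  elim: m nm {Cb} => // m IH; rewrite ltnS leq_eqVlt => /orP[/eqP->|/IH].
    by rewrite /= inE eqxx.
  by rewrite /= inE orbC => ->.
have bn : b m - b n != 0.
  by rewrite subr_eq0; apply: contraTneq bD => <-; case: (FP (Ds m)).
have [l Cl] := inC_neq0 Cb bn.
by apply: (kills_trans (l := l)) => //; rewrite opprD addrA.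
Qed.

(** Nonzero cohomology occurs only in degrees of D - C. One D serves all i, since the hypothesis of
    [Van_nzd] ranges over all cohomological degrees. *)
Definition bounded_above L N := exists D : seq 'rV[int]_d, forall i a,
  (forall e, e \in D -> ~ C (e - a)) -> Van gens act L N i a.

Lemma bounded_above_killed L N : submod L -> submod N ->
  (forall l, kills l L N) -> bounded_above L N.
Proof.
move=> sL sN kl; have [D DP] := killed_finite sL sN kl.
(* Raising the exponent by one multiplies f S by x^(gsum S), which for nonempty S is divisible by
   some x_j and so sends L into N. On the empty face the degree is a, outside D because a - a = 0
   lies in C. *)
exists D => i a aD n f Lf df; exists n.+1, (fun=> 0); split=> // [S|S cS].
  exact: (submod0 sL).
rewrite cech_d_const0 subr0.
have [S0|[j jS]] := set_0Vmem S.
  have Na : N _ (f S).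
    apply: DP => //; apply/negP => /aD; apply.
    by rewrite S0 /shift /gsum big_set0 mul0rn addr0 subrr; apply: inC0.
  by apply: (submod_act sN) => //; apply: inC_shift.
apply: (kills_trans (l := j)) => //.
rewrite opprD addrA shiftB // subSnn mulr1n (gsumD1 _ jS) addrAC subrr add0r.
exact: inC_gsum.
Qed.

Lemma bounded_above_ext P N L : submod P -> submod N -> submod L ->
  submod_le P N -> submod_le N L ->
  bounded_above L N -> bounded_above N P -> bounded_above L P.
Proof.
move=> sP sN sL PN NL [D1 H1] [D2 H2]; exists (D1 ++ D2) => i a aD.
by apply: (Van_ext HM sP sN sL) => //; [apply: H1|apply: H2] => e eD;
  apply: aD; rewrite mem_cat eD ?orbT.
Qed.
End Noetherian.

(** * Devissage by power torsion *)

Section Boundedness.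
Variables (K : fieldType) (d k : nat) (gens : 'I_k -> 'rV[int]_d)
  (M : 'rV[int]_d -> lmodType K) (act : forall a b, {linear M a -> M b})
  (HM : graded_module gens act) (Hfg : fin_gen gens act).
Local Notation C := (inC gens).
Local Notation sh := (shift gens).
Local Notation submod := (graded_submod gens act).
Local Notation kills := (kills gens act).
Local Notation bounded_above := (bounded_above gens act).
Implicit Types (T S U : {set 'I_k}) (L N P : forall a, M a -> Prop).

Definition pow_torsion l N L n : forall b, M b -> Prop :=
  fun b v => L b v /\ N _ (act b (b + gens l *+ n) v).

Lemma inC_addMn l b n : C (b + gens l *+ n - b).
Proof. by rewrite addrAC subrr add0r; apply/inCMn/inC_gen. Qed.

Section PowTorsion.
Variables (l : 'I_k) (N L : forall a, M a -> Prop).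
Hypotheses (sN : submod N) (sL : submod L) (NL : submod_le N L).
Local Notation G := (pow_torsion l N L).

Lemma pow_torsion_submod n : submod (G n).
Proof.
split=> [a|a x u v [Lu Nu] [Lv Nv]|a b v Cab [Lv Nv]].
- by split; rewrite ?linear0; [exact: (submod0 sL)|exact: (submod0 sN)].
- split; first by case: sL => _ H _; apply: H.
  by rewrite linearP; case: sN => _ H _; apply: H.
- split; first exact: (submod_act sL).
  rewrite (act_comp HM) //; last exact: inC_addMn.
  have Cn : C (b + gens l *+ n - (a + gens l *+ n)).
    by rewrite opprD addrACA subrr addr0.
  rewrite -(act_comp HM (b := a + gens l *+ n)) //; last exact: inC_addMn.
  exact: (submod_act sN).
Qed.

Lemma sub_pow_torsion n : submod_le N (G n).
Proof.
move=> b v Nv; split; first exact: NL.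
by apply: (submod_act sN) => //; apply: inC_addMn.
Qed.

Lemma pow_torsion_sub n : submod_le (G n) L.
Proof. by move=> b v []. Qed.

Lemma pow_torsion0 : submod_le (G 0) N.
Proof.
move=> b v [_ Nv]; rewrite -[v](act_id HM).
rewrite -(act_comp HM (b := b + gens l *+ 0)).
- by apply: (submod_act sN); rewrite // mulr0n addr0 subrr; apply: inC0.
- exact: inC_addMn.
- by rewrite mulr0n addr0 subrr; apply: inC0.
Qed.

(** From left to right, x_l kills each layer of the torsion filtration. From right to left, once the
    filtration is stable, x_l is regular on the quotient. *)
Lemma pow_torsionS n b c (v : M b) : c = b + gens l -> L v ->
  G n.+1 v <-> G n (act b c v).
Proof.
move=> cb Lv; have Cbc : C (c - b) by rewrite cb addrAC subrr add0r; apply: inC_gen.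
have ce : c + gens l *+ n = b + gens l *+ n.+1 by rewrite cb -addrA mulrS.
split=> -[_ Nv]; split=> //; first exact: (submod_act sL).
  by rewrite (act_comp HM) //; [rewrite ce|exact: inC_addMn].
by move: Nv; rewrite (act_comp HM) //; [rewrite ce|exact: inC_addMn].
Qed.

Lemma pow_torsion_inc n : submod_le (G n) (G n.+1).
Proof.
move=> b v Gv; have Lv := pow_torsion_sub Gv.
apply/(pow_torsionS n (erefl _) Lv).
apply: (submod_act (pow_torsion_submod n)) => //.
by rewrite addrAC subrr add0r; apply: inC_gen.
Qed.

Lemma pow_torsion_stable : exists n, submod_le (G n.+1) (G n).
Proof.
apply: contrapT => /forallNP H.
have H' n : exists b, exists v : M b, G n.+1 v /\ ~ G n v.
  apply: contrapT => /forallNP H'; apply: (H n) => b v Gv.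
  by apply: contrapT => nG; apply: (H' b); exists v.
have [b bP] := choice H'.
pose v n := projT1 (cid (bP n)).
have Gv n : G n.+1 (v n) by rewrite /v; case: (cid _) => ? [].
have nGv n : ~ G n (v n) by rewrite /v; case: (cid _) => ? [].
apply: (@noetherian _ _ _ _ _ _ HM Hfg b v G) => //.
- exact: pow_torsion_submod.
- exact: pow_torsion_inc.
- move=> n m nm Cb; apply: (submod_act (pow_torsion_submod m)) => //.
  elim: m nm {Cb} => // m IH; rewrite ltnS leq_eqVlt => /orP[/eqP<-//|/IH].
  exact: pow_torsion_inc.
Qed.
End PowTorsion.

(** Its size is the measure of the devissage: each smaller subquotient stays killed by the variables
    that kill L / N and is killed by x_l as well. *)
Definition unkilled L N : {set 'I_k} := [set l | ~~ `[< kills l L N >]].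

Lemma unkilled_lt l L N L' N' : ~ kills l L N -> kills l L' N' ->
  (forall z, kills z L N -> kills z L' N') ->
  (#|unkilled L' N'| < #|unkilled L N|)%N.
Proof.
move=> nkl kl kz; apply: proper_card; apply/properP; split.
  by apply/subsetP => z; rewrite !inE => /asboolPn nz; apply/asboolPn => /kz.
by exists l; rewrite !inE; [apply/asboolPn|rewrite negbK; apply/asboolP].
Qed.

(* Devissage: split off the x_l-power torsion, whose layers are killed by x_l;
   on the quotient x_l is regular and one passes to the quotient by x_l. *)
Lemma bounded_above_subquotient L N : submod L -> submod N -> submod_le N L ->
  bounded_above L N.
Proof.
have [s] := ubnP #|unkilled L N|; elim: s => // s IH in L N *.
rewrite ltnS => cs sL sN NL.
have [kl|/existsNP[l nkl]] := pselect (forall l, kills l L N).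
  exact: (bounded_above_killed HM Hfg).
pose G := pow_torsion l N L.
have sG n : submod (G n) by apply: pow_torsion_submod.
have GL n : submod_le (G n) L by apply: pow_torsion_sub.
have NG n : submod_le N (G n) by apply: sub_pow_torsion.
have IHl L' N' : submod L' -> submod N' -> submod_le N' L' -> kills l L' N' ->
    (forall z, kills z L N -> kills z L' N') -> bounded_above L' N'.
  move=> sL' sN' NL' kl kz; apply: IH => //.
  exact: leq_trans (unkilled_lt nkl kl kz) cs.
have bG n : bounded_above (G n) N.
  elim: n => [|n IHn].
    apply: (bounded_above_killed HM Hfg) => // z b c v cb /(pow_torsion0 sN) Nv.
    by apply: (submod_act sN) => //; rewrite cb addrAC subrr add0r; apply: inC_gen.
  apply: (bounded_above_ext HM (N := G n)) => //; first exact: pow_torsion_inc.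
  apply: IHl => //; first exact: pow_torsion_inc.
    by move=> b c v cb Gv; apply/(pow_torsionS N sL n cb (GL n.+1 b v Gv)).
  by move=> z kz b c v cb [Lv _]; apply: (NG n); apply: kz.
have [n Gn] := pow_torsion_stable l sN sL.
apply: (bounded_above_ext HM (N := G n)) => //.
have sQ := submod_add_mul HM l (sG n) sL.
have [D DP] : bounded_above L (add_submod (G n) (mul_submod gens act l L)).
  apply: IHl => //.
  - move=> b v [u [_ [[Lu _] [w Lw ->] ->]]].
    by apply: (submodD sL) => //; apply: (submod_act sL) => //; apply: inC_subgen.
  - move=> b c v cb Lv; exists 0, (act b c v); rewrite add0r; split=> //.
      exact: submod0.
    have e : c - gens l = b by rewrite cb addrK.
    have C0 : C (c - gens l - b) by rewrite e subrr; apply: inC0.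
    exists (act b (c - gens l) v); first exact: (submod_act sL).
    by rewrite (act_comp HM) //; apply: inC_subgen.
  - move=> z kz b c v cb Lv; exists (act b c v), 0; rewrite addr0; split=> //.
      by apply: (NG n); apply: kz.
    by exists 0; rewrite ?linear0 //; apply: (submod0 sL).
exists D => i a aD; apply: (Van_nzd HM (l := l)) => //.
  by move=> b c v cb Lv Gv; apply/Gn/(pow_torsionS N sL n cb Lv).
(* Adding multiples of g_l to a cannot lead back into D - C. *)
move=> q j; apply: DP => e eD Ce; apply: (aD e eD).
by apply: inC_sub_trans Ce; apply: inC_addMn.
Qed.

Lemma Cech_bounded_above : exists D : seq 'rV[int]_d, forall i a,
  (forall e, e \in D -> ~ C (e - a)) -> H_vanishes gens act i a.
Proof.
pose L a (v : M a) := True; pose N a (v : M a) := v = 0.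
have sL : submod L by [].
have sN : submod N.
  split=> // [a x u v -> ->|a b v _ ->]; first by rewrite scaler0 addr0.
  exact: linear0.
have [D DP] := bounded_above_subquotient sL sN (fun _ _ _ => I).
exists D => i a aD n f fc.
(* [is_cocycle] allows an exponent for each face; at their maximum the lifted differential is zero
   outright, as [Van] expects. *)
have [m [nm fm]] : exists m, (n <= m)%N /\ forall T, #|T| = i.+1 ->
    cech_d act (Defs.lift act m f) T = 0.
  have H T : exists m, (n <= m)%N /\ (#|T| = i.+1 ->
      act (sh a n T) (sh a m T) (cech_d act f T) = 0).
    have [/fc[m [nm e]]|ne] := pselect (#|T| = i.+1); first by exists m.
    by exists n.
  have [mT mP] := choice H.
  exists (\max_T maxn n (mT T))%N; have le T : (mT T <= \max_T maxn n (mT T))%N.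
    by apply: leq_trans (leq_bigmax T); apply: leq_maxr.
  have nm : (n <= \max_T maxn n (mT T))%N.
    by apply: leq_trans (leq_bigmax set0); apply: leq_maxl.
  split=> // T cT; rewrite (cech_d_lift HM) //.
  rewrite -(act_comp HM (b := sh a (mT T) T)); try exact: inC_shift.
    by rewrite (proj2 (mP T)) // linear0.
  by apply: inC_shift; case: (mP T).
have [m' [g [mm' _ fg]]] := DP i a aD m _ (fun _ => I) fm.
exists m', g => S cS; exists m'; split=> //; first exact: leq_trans mm'.
rewrite (act_id HM) -(act_comp HM (b := sh a m S)); try exact: inC_shift.
by apply/eqP; rewrite -subr_eq0; apply/eqP; apply: fg.
Qed.
End Boundedness.

(** * Lattice points of the cone and its facets *)

Section Cone.
Variables (R : realFieldType) (d k : nat) (gens : 'I_k -> 'rV[int]_d).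
Local Notation C := (inC gens).
Implicit Types (a b c e : 'rV[int]_d) (v : 'rV[R]_d).

Lemma toR_rat a : toR R a = map_mx ratr (toR rat a).
Proof. by apply/rowP => i; rewrite !mxE ratr_int. Qed.

Lemma toR_inj (F : realFieldType) a b : toR F a = toR F b -> a = b.
Proof. by move=> /rowP e; apply/rowP => i; have := e i; rewrite !mxE => /intr_inj. Qed.

Lemma toR_sum (F : realFieldType) (I : Type) (r : seq I) (P : pred I) (G : I -> 'rV[int]_d) :
  toR F (\sum_(x <- r | P x) G x) = \sum_(x <- r | P x) toR F (G x).
Proof.
apply/rowP => i; rewrite mxE !summxE rmorph_sum.
by apply: eq_bigr => x _; rewrite mxE.
Qed.

Lemma toRMn (F : realFieldType) a n : toR F (a *+ n) = n%:R *: toR F a.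
Proof. by apply/rowP => i; rewrite !mxE mulmxnE rmorphMn mulr_natl. Qed.

(** The data are rational, and inclusion in a row space descends from R to the rationals. *)
Lemma rat_span (S : {set 'I_k}) a (lam : 'I_k -> R) :
  toR R a = \sum_(l in S) lam l *: toR R (gens l) ->
  exists q : 'I_k -> rat, toR R a = \sum_(l in S) ratr (q l) *: toR R (gens l) /\
    toR rat a = \sum_(l in S) q l *: toR rat (gens l).
Proof.
move=> ea.
pose A : 'M[rat]_(k, d) := \matrix_l (if l \in S then toR rat (gens l) else 0).
have : (toR R a <= map_mx ratr A)%MS.
  apply/submxP; exists (\row_l lam l); rewrite mulmx_sum_row ea big_mkcond.
  apply: eq_bigr => l _; rewrite mxE -map_row rowK.
  by case: ifP => _; rewrite -?toR_rat // map_mx0 scaler0.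
rewrite toR_rat map_submx => /submxP[D eD]; exists (D 0).
have e : toR rat a = \sum_(l in S) D 0 l *: toR rat (gens l).
  rewrite eD mulmx_sum_row [RHS]big_mkcond; apply: eq_bigr => l _.
  by rewrite rowK; case: ifP => // _; rewrite scaler0.
split; last exact: e.
rewrite e map_mx_sum; apply: eq_bigr => l _.
by rewrite map_mxZ -toR_rat.
Qed.

Lemma clear_denominators (I : finType) (q : I -> rat) : (forall l, 0 <= q l) ->
  exists (m : nat) (n : I -> nat), (0 < m)%N /\ forall l, m%:R * q l = (n l)%:R.
Proof.
move=> q0; exists (\prod_l `|denq (q l)|)%N.
exists (fun l => (\prod_(j | j != l) `|denq (q j)|) * `|numq (q l)|)%N; split.
  by apply: prodn_gt0 => l; rewrite absz_gt0 denq_neq0.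
move=> l; rewrite (bigD1 l) //= mulnC !natrM -mulrA; congr (_ * _).
have nz : `|denq (q l)|%:R != 0 :> rat by rewrite pnatr_eq0 -lt0n absz_gt0 denq_neq0.
rewrite -{2}[q l]divq_num_den mulrC.
have -> : (denq (q l))%:~R = `|denq (q l)|%:R :> rat.
  by rewrite natr_absz gtr0_norm ?denq_gt0.
by rewrite divfK // natr_absz ger0_norm // numq_ge0.
Qed.

(** Caratheodory's argument, by induction on the size of the support. If the coefficients agree with
    a rational solution on the support, clear denominators. Otherwise the difference is a linear
    relation, and moving along it removes a generator. *)
Lemma cone_lattice a : in_cone gens (toR R a) -> exists2 m, (0 < m)%N & C (a *+ m).
Proof.
case=> lam [lam0 ea].
have [s] := ubnP #|[set l | lam l != 0]|; elim: s => // s IH in lam lam0 ea *.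
set S := [set l | lam l != 0] => cS.
have eS : toR R a = \sum_(l in S) lam l *: toR R (gens l).
  rewrite ea [RHS]big_mkcond; apply: eq_bigr => l _.
  by rewrite inE; case: eqP => //= ->; rewrite scale0r.
have [q [eq eqQ]] := rat_span eS.
pose rho l := if l \in S then lam l - ratr (q l) else 0.
have rho_sum : \sum_l rho l *: toR R (gens l) = 0.
  rewrite /rho (eq_bigr (fun l => if l \in S then
    lam l *: toR R (gens l) - ratr (q l) *: toR R (gens l) else 0)); last first.
    by move=> l _; case: ifP => _; rewrite ?scale0r // scalerBl.
  by rewrite -big_mkcond sumrB -eS -eq subrr.
have reduce (mu : 'I_k -> R) : (forall l, l \notin S -> mu l = 0) ->
    \sum_l mu l *: toR R (gens l) = 0 -> (exists l, 0 < mu l) ->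
    exists2 m, (0 < m)%N & C (a *+ m).
  move=> muS mu_sum [l0 mu0].
  (* The smallest ratio: subtracting t mu keeps every coefficient nonnegative and makes that of l1
     vanish. *)
  case: (@arg_minP _ R _ l0 (fun l => 0 < mu l) (fun l => lam l / mu l) mu0) => l1 mu1 min.
  pose t := lam l1 / mu l1; pose lam' l := lam l - t * mu l.
  have t0 : 0 <= t by rewrite divr_ge0 // ltW.
  have lam'0 l : 0 <= lam' l.
    rewrite subr_ge0; have [mul|mul] := ltrP 0 (mu l).
      by rewrite -ler_pdivlMr // min.
    by apply: le_trans (lam0 l); rewrite mulr_ge0_le0.
  apply: (IH lam' lam'0); last first.
    rewrite -ltnS; apply: leq_trans cS; rewrite ltnS; apply: proper_card; apply/properP; split.
      apply/subsetP => l; rewrite inE; apply: contraR => lS.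
      rewrite /lam' muS // mulr0 subr0; apply/eqP; move: lS.
      by rewrite inE negbK => /eqP.
    exists l1; last by rewrite inE negbK /lam' /t divfK ?subrr // gt_eqF.
    by apply: contraLR mu1 => /muS->; rewrite ltxx.
  rewrite /lam' (eq_bigr (fun l => lam l *: toR R (gens l) -
    t *: (mu l *: toR R (gens l)))) => [|l _]; last by rewrite scalerBl scalerA.
  by rewrite sumrB -scaler_sumr mu_sum scaler0 subr0.
have [rho0|/existsNP[l0 /eqP nrho]] := pselect (forall l, rho l = 0).
  have q0 l : 0 <= (if l \in S then q l else 0).
    case: ifP => // lS; have := rho0 l; rewrite /rho lS => /eqP.
    by rewrite subr_eq0 => /eqP e; rewrite -(ler0q R) -e.
  have [m [n [m0 mn]]] := clear_denominators q0.
  exists m => //; exists n; apply: (@toR_inj rat).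
  rewrite toRMn eqQ toR_sum scaler_sumr big_mkcond; apply: eq_bigr => l _.
  by rewrite toRMn -mn; case: ifP => _; rewrite ?mulr0 ?scale0r // scalerA.
have rhoS l : l \notin S -> rho l = 0 by rewrite /rho => /negPf->.
have [rp|rn|r0] := ltrgtP 0 (rho l0).
- by apply: (reduce rho) => //; exists l0.
- apply: (reduce (fun l => - rho l)); last by exists l0; rewrite oppr_gt0.
    by move=> l /rhoS->; rewrite oppr0.
  rewrite (eq_bigr (fun l => - (rho l *: toR R (gens l)))) => [|l _].
    by rewrite sumrN rho_sum oppr0.
  by rewrite scaleNr.
- by rewrite -r0 eqxx in nrho.
Qed.

Variables (t : nat) (h : 'I_t -> 'rV[R]_d).
Hypotheses (HZC : generates_group gens) (Hh : facet_system gens h).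

Lemma hfP j (x : R) u v : hf (h j) (x *: u + v) = x * hf (h j) u + hf (h j) v.
Proof.
rewrite /hf mulr_sumr -big_split; apply: eq_bigr => i _.
by rewrite !mxE mulrDr mulrCA.
Qed.

Lemma hf0 j : hf (h j) 0 = 0.
Proof. by rewrite /hf big1 // => i _; rewrite mxE mulr0. Qed.

Lemma hfZ j (x : R) u : hf (h j) (x *: u) = x * hf (h j) u.
Proof. by rewrite -[x *: u]addr0 hfP hf0 addr0. Qed.

Lemma hf_sum j (I : Type) (r : seq I) (P : pred I) (G : I -> 'rV[R]_d) :
  hf (h j) (\sum_(x <- r | P x) G x) = \sum_(x <- r | P x) hf (h j) (G x).
Proof.
elim/big_rec2: _ => [|x u v _ <-]; first exact: hf0.
by rewrite -(mul1r (hf (h j) (G x))) -hfP scale1r.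
Qed.

Local Notation hz j a := (hf (h j) (toR R a)).

Lemma hzD j a b : hz j (a + b) = hz j a + hz j b.
Proof.
rewrite -[hz j a]mul1r -hfP scale1r; congr hf.
by apply/rowP => i; rewrite !mxE rmorphD.
Qed.

Lemma hz0 j : hz j 0 = 0.
Proof. by apply: (addrI (hz j 0)); rewrite -hzD !addr0. Qed.

Lemma hzN j a : hz j (- a) = - hz j a.
Proof. by apply/eqP; rewrite -addr_eq0 -hzD addNr hz0. Qed.

Lemma hzB j a b : hz j (a - b) = hz j a - hz j b.
Proof. by rewrite hzD hzN. Qed.

Lemma hzMn j a n : hz j (a *+ n) = hz j a * n%:R.
Proof. by rewrite toRMn hfZ mulrC. Qed.

Lemma hz_sum j (I : Type) (r : seq I) (P : pred I) (G : I -> 'rV[int]_d) :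
  hz j (\sum_(x <- r | P x) G x) = \sum_(x <- r | P x) hz j (G x).
Proof. by rewrite toR_sum hf_sum. Qed.

Lemma hz_gen_ge0 j l : 0 <= hz j (gens l).
Proof.
apply: (proj1 (proj1 Hh _)); exists (fun x => (x == l)%:R); split=> [x|].
  exact: ler0n.
rewrite (bigD1 l) //= eqxx scale1r big1 ?addr0 // => x /negPf->.
by rewrite scale0r.
Qed.

Lemma hz_ge0 j c : C c -> 0 <= hz j c.
Proof.
move=> [m ->]; rewrite hz_sum; apply: sumr_ge0 => l _.
by rewrite hzMn mulr_ge0 ?hz_gen_ge0.
Qed.

(** If h_j vanished on all generators it would vanish on Z^d, hence be zero, and removing it would
    not enlarge the cone, against minimality. *)
Lemma hz_gens_gt0 j : 0 < hf (h j) (\sum_l toR R (gens l)).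
Proof.
have ge0 : 0 <= hf (h j) (\sum_l toR R (gens l)).
  by rewrite hf_sum; apply: sumr_ge0 => l _; apply: hz_gen_ge0.
rewrite lt_def ge0 andbT; apply/negP => /eqP; rewrite hf_sum => /psumr_eq0P s0.
have hl l : hz j (gens l) = 0 by apply: s0 => // i _; apply: hz_gen_ge0.
have ha a : hz j a = 0.
  have [z ->] := HZC a; rewrite hz_sum big1 // => l _.
  by case: (z l) => n; rewrite ?NegzE ?mulrNz ?hzN -pmulrn hzMn hl mul0r ?oppr0.
have hj i : h j 0 i = 0.
  have := ha (delta_mx 0 i); rewrite /hf (bigD1 i) //= big1 ?addr0.
    by rewrite !mxE !eqxx mulr1.
  by move=> i' ne; rewrite !mxE (negPf ne) andbF mulr0.
have [u [uj nu]] := proj2 Hh j; apply: nu; apply/(proj1 Hh) => j'.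
have [->|/uj//] := eqVneq j' j.
by rewrite /hf big1 // => i _; rewrite hj mul0r.
Qed.

(** Take a point u violating only h_j and the interior point p. The segment from p to u crosses h_j
    = 0 at a positive multiple of w. *)
Lemma facet_point j : exists w : 'rV[R]_d,
  hf (h j) w = 0 /\ forall i, i != j -> 0 < hf (h i) w.
Proof.
have [u [uj nu]] := proj2 Hh j.
have un : hf (h j) u < 0.
  rewrite ltNge; apply/negP => u0; apply: nu; apply/(proj1 Hh) => i.
  by have [->|/uj] := eqVneq i j.
pose p := \sum_l toR R (gens l).
exists (hf (h j) p *: u + (- hf (h j) u) *: p); split=> [|i /uj ui].
  by rewrite hfP hfZ; ring.
rewrite hfP hfZ ltr_wpDl //; first by rewrite mulr_ge0 // ltW // hz_gens_gt0.
by rewrite mulr_gt0 ?oppr_gt0 // hz_gens_gt0.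
Qed.

Lemma cone_facet_span j z : in_cone gens z -> hf (h j) z = 0 ->
  exists lam : 'I_k -> R, z = \sum_(l | hz j (gens l) == 0) lam l *: toR R (gens l).
Proof.
case=> lam [lam0 ez] z0; exists lam; rewrite ez (bigID (fun l => hz j (gens l) == 0)) /=.
rewrite [X in _ + X]big1 ?addr0 // => l nl.
have /psumr_eq0P s0 : \sum_l lam l * hz j (gens l) = 0.
  by rewrite -[RHS]z0 ez hf_sum; apply: eq_bigr => i _; rewrite hfZ.
have /eqP := s0 (fun i _ => mulr_ge0 (lam0 i) (hz_gen_ge0 j i)) l isT.
by rewrite mulf_eq0 (negPf nl) orbF => /eqP->; rewrite scale0r.
Qed.

(* A relative interior point of the facet shows that the generators on it span
   the hyperplane h_j = 0. *)
Lemma facet_span j v : hf (h j) v = 0 ->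
  exists lam : 'I_k -> R, v = \sum_(l | hz j (gens l) == 0) lam l *: toR R (gens l).
Proof.
move=> v0; have [w [w0 wi]] := facet_point j.
(* So large that s w + v stays in the cone; then v is the difference of the two facet points s w + v
   and s w. *)
pose s := \sum_(i | i != j) `|hf (h i) v| / hf (h i) w.
have sge i : i != j -> `|hf (h i) v| <= s * hf (h i) w.
  move=> ij; rewrite -ler_pdivrMr ?wi // /s (bigD1 i) //= lerDl.
  by apply: sumr_ge0 => x /andP[xj _]; rewrite divr_ge0 // ltW // wi.
have s0 : 0 <= s by apply: sumr_ge0 => x xj; rewrite divr_ge0 // ltW // wi.
have [||lam1 e1] := @cone_facet_span j (s *: w + v).
- apply/(proj1 Hh) => i; rewrite hfP; have [->|ij] := eqVneq i j.
    by rewrite w0 v0 mulr0 addr0.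
  by have := sge i ij; have := ler_norm (- hf (h i) v); rewrite normrN; lra.
- by rewrite hfP w0 v0 mulr0 addr0.
have [||lam2 e2] := @cone_facet_span j (s *: w).
- apply/(proj1 Hh) => i; rewrite hfZ; have [->|ij] := eqVneq i j.
    by rewrite w0 mulr0.
  by rewrite mulr_ge0 // ltW // wi.
- by rewrite hfZ w0 mulr0.
exists (fun l => lam1 l - lam2 l).
rewrite -[LHS](addKr (s *: w)) e1 addrC e2 -sumrB.
by apply: eq_bigr => l _; rewrite scalerBl.
Qed.

(* R need not be archimedean: the bound exists because the facets are spanned
   by lattice points. *)
Lemma hz_archimedean j l0 e : 0 < hz j (gens l0) ->
  exists B : nat, hz j e < hz j (gens l0) * B%:R.
Proof.
(* e - r g_l0 lies on h_j = 0, so e is a combination of g_l0 and generators on the facet. Making it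
   rational turns the ratio r into the image of a rational number. *)
move=> g0; pose r := hz j e / hz j (gens l0).
have [|lam elam] := @facet_span j (- r *: toR R (gens l0) + toR R e).
  by rewrite hfP mulNr divfK ?gt_eqF // addNr.
pose S := [set l | (hz j (gens l) == 0) || (l == l0)].
have [|q [eq _]] := @rat_span S e (fun l => if l == l0 then r else lam l).
  rewrite (bigD1 l0) ?inE ?eqxx ?orbT //=.
  rewrite -[LHS](addKr (- r *: toR R (gens l0))) elam scaleNr opprK; congr (_ + _).
  rewrite [RHS](eq_bigl (fun l => hz j (gens l) == 0)) => [|l].
    by apply: eq_bigr => l /eqP hl; case: eqP => // el; rewrite -el hl ltxx in g0.
  rewrite inE; case: (eqVneq l l0) => [->|_]; last by rewrite orbF andbT.
  by rewrite andbF gt_eqF.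
have he : hz j e = ratr (q l0) * hz j (gens l0).
  rewrite eq hf_sum (bigD1 l0) ?inE ?eqxx ?orbT //= hfZ big1 ?addr0 // => l.
  by rewrite inE hfZ => /andP[/orP[/eqP->|->//] _]; rewrite mulr0.
exists (Num.bound `|q l0|); rewrite he mulrC ltr_pM2l //.
rewrite -(ratr_nat R) ltr_rat; apply: le_lt_trans (ler_norm _) _.
exact: archi_boundP.
Qed.

Lemma hz_gsum_bound (S : {set 'I_k}) w :
  (forall j, 0 < hz j w -> 0 < hz j (gsum gens S)) ->
  exists B : nat, forall j, hz j w <= hz j (gsum gens S) * B%:R.
Proof.
move=> H; have HB j : exists B : nat, hz j w <= hz j (gsum gens S) * B%:R.
  have [wj|/H gj] := lerP (hz j w) 0; first by exists 0%N; rewrite mulr0.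
  have [l lS gl] : exists2 l, l \in S & 0 < hz j (gens l).
    apply: contrapT => /forall2NP nl; move: gj.
    rewrite hz_sum big1 ?ltxx // => l lS; apply/eqP; rewrite eq_le hz_gen_ge0 andbT.
    by rewrite leNgt; apply/negP; case: (nl l).
  have [B /ltW eB] := hz_archimedean w gl; exists B; apply: le_trans eB _.
  rewrite ler_wpM2r ?ler0n // hz_sum (bigD1 l) //= lerDl.
  by apply: sumr_ge0 => x _; apply: hz_gen_ge0.
have [B BP] := choice HB; exists (\max_j B j)%N => j.
apply: le_trans (BP j) _; rewrite ler_wpM2l ?hz_ge0 ?ler_nat ?leq_bigmax //.
exact: inC_gsum.
Qed.

(* x^w is invertible in the localisation at x^(gsum S). *)
Lemma inC_gsum_sub (S : {set 'I_k}) w : C w ->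
  (forall j, 0 < hz j w -> 0 < hz j (gsum gens S)) ->
  exists B : nat, C (gsum gens S *+ B - w).
Proof.
move=> Cw /hz_gsum_bound[B BP].
have [|[//|m] _ Cm] := @cone_lattice (gsum gens S *+ B - w).
  by apply/(proj1 Hh) => j; rewrite hzB hzMn subr_ge0.
(* Only the (m+1)-fold multiple of B gsum S - w is known to lie in C; adding m copies of w leaves a
   single -w. *)
exists (B * m.+1)%N.
rewrite (_ : _ - w = (gsum gens S *+ B - w) *+ m.+1 + w *+ m).
  by apply: inCD => //; apply: inCMn.
by rewrite mulrnBl -mulrnA [w *+ m.+1]mulrS opprD addrA subrK.
Qed.
End Cone.

(** * Finite dimension of the graded pieces of cohomology *)

Section FiniteDimension.
Variables (K : fieldType) (d k : nat) (gens : 'I_k -> 'rV[int]_d)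
  (M : 'rV[int]_d -> lmodType K) (act : forall a b, {linear M a -> M b})
  (HM : graded_module gens act) (Hfg : fin_gen gens act).
Local Notation C := (inC gens).
Local Notation sh := (shift gens).
Implicit Types (T S U : {set 'I_k}) (a : 'rV[int]_d).

Lemma cocycle_linear i a n (x : K) (f f' : forall S, M (sh a n S)) :
  is_cocycle act i f -> is_cocycle act i f' ->
  is_cocycle act i (fun S => x *: f S + f' S).
Proof.
move=> cf cf' T cT; have [N [nN e]] := cf T cT; have [N' [nN' e']] := cf' T cT.
exists (maxn N N'); split; first exact: leq_trans (leq_maxl _ _).
rewrite cech_d_linear linearP.
rewrite -(act_comp HM (b := sh a N T)) ?e ?linear0 ?scaler0 ?add0r;
  try by apply: inC_shift; rewrite ?leq_maxl.
rewrite -(act_comp HM (b := sh a N' T)) ?e' ?linear0 //;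
  by apply: inC_shift; rewrite ?leq_maxr.
Qed.

Lemma cocycle0 i a n : is_cocycle act i (fun S => 0 : M (sh a n S)).
Proof. by move=> T _; exists n; rewrite cech_d_const0 linear0. Qed.

Lemma cocycle_of_lift i a n m N (f : forall S, M (sh a n S)) (f' : forall S, M (sh a m S)) :
  (n <= N)%N -> (m <= N)%N -> (forall S, Defs.lift act N f S = Defs.lift act N f' S) ->
  is_cocycle act i f -> is_cocycle act i f'.
Proof.
move=> nN mN eff' cf T cT; have [N1 [nN1 e]] := cf T cT.
exists (maxn N N1); split; first by apply: leq_trans mN (leq_maxl _ _).
rewrite -(act_comp HM (b := sh a N T)); try by apply: inC_shift; rewrite ?leq_maxl.
rewrite -(cech_d_lift HM) // -(@functional_extensionality_dep _ _ _ _ eff').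
rewrite (cech_d_lift HM) // (act_comp HM); try by apply: inC_shift; rewrite ?leq_maxl.
rewrite -(act_comp HM (b := sh a N1 T)) ?e ?linear0 //;
  by apply: inC_shift; rewrite ?leq_maxr.
Qed.

(** For each face, the generators lying below its degree stabilise as the exponent grows, so every
    cochain agrees after lifting with one of the fixed exponent n0. Those come from a
    finite-dimensional coefficient space, in which the cocycle condition cuts out a subspace. *)
Lemma Cech_findim i a : H_findim gens act i a.
Proof.
have [p [deg [g gP]]] := Hfg.
have Hn (x : {set 'I_k} * 'I_p) : exists n0, forall n,
    C (sh a n x.1 - deg x.2) -> C (sh a n0 x.1 - deg x.2).
  have [[n0 Cn]|/forallNP nC] := pselect (exists n, C (sh a n x.1 - deg x.2)).
    by exists n0.
  by exists 0%N => n /nC.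
have [nf nfP] := choice Hn.
pose n0 := (\max_x nf x)%N.
have Cn0 n S l : C (sh a n S - deg l) -> C (sh a n0 S - deg l).
  move/(nfP (S, l)) => /= Cn; apply: (inC_sub_trans Cn).
  exact/inC_shift/(leq_bigmax (S, l)).
pose m := #|{: {set 'I_k} * 'I_p}|.
pose ev (c : 'rV[K]_m) S : M (sh a n0 S) :=
  \sum_l (c 0 (enum_rank (S, l)) *+ `[< C (sh a n0 S - deg l) >]) *:
    act (deg l) (sh a n0 S) (g l).
have evP x c c' : ev (x *: c + c') = fun S => x *: ev c S + ev c' S.
  apply: functional_extensionality_dep => S.
  rewrite scaler_sumr -big_split; apply: eq_bigr => l _.
  by rewrite !mxE mulrnDl scalerDl scalerA mulrnAr.
have ev0 : ev 0 = fun S => 0.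
  by apply: functional_extensionality_dep => S; rewrite [LHS]big1 // => l _;
    rewrite mxE mul0rn scale0r.
have [|A AP] := @subspace_mx K m (fun c => is_cocycle act i (ev c)).
  split=> [|x u v cu cv]; first by rewrite ev0; apply: cocycle0.
  by rewrite evP; apply: cocycle_linear.
exists m, n0, (fun l => ev (row l A)); split=> [l|n f cf].
  by apply/AP/row_sub.
pose N := maxn n n0.
have [nN n0N] : (n <= N)%N /\ (n0 <= N)%N by rewrite leq_maxl leq_maxr.
have [cc ccP] := choice (fun S => gP (sh a N S) (Defs.lift act N f S)).
pose c : 'rV[K]_m := \row_x cc (enum_val x).1 (enum_val x).2.
have lift_c S : Defs.lift act N f S = Defs.lift act N (ev c) S.
  rewrite (proj2 (ccP S)) /Defs.lift linear_sum; apply: eq_bigr => l _.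
  rewrite linearZ_LR mxE enum_rankK /=.
  have [CN|nCN] := pselect (C (sh a N S - deg l)); last first.
    by rewrite (proj1 (ccP S)) // mul0rn !scale0r.
  have Cl := Cn0 _ _ _ CN.
  by rewrite (asboolT Cl) (act_comp HM) //; apply: inC_shift.
have /AP/submxP[D eD] := cocycle_of_lift nN n0N lift_c cf.
exists (fun l => D 0 l), N; split=> //.
have evD S : ev c S = \sum_(l < m) D 0 l *: ev (row l A) S.
  rewrite eD mulmx_sum_row.
  elim/big_rec2: _ => [|l u v _ <-]; first by rewrite ev0.
  by rewrite evP.
exists N, (fun S => 0) => S _; exists N; split=> //.
rewrite cech_d_const0 linear0 lift_c /Defs.lift evD linear_sum.
rewrite [X in _ - X](eq_bigr (fun l =>
  act (sh a n0 S) (sh a N S) (D 0 l *: ev (row l A) S))) => [|l _].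
  by rewrite subrr linear0.
by rewrite linearZ_LR.
Qed.
End FiniteDimension.

(** * Periodicity of the cohomology in negative directions *)

Section Periodicity.
Variables (K : fieldType) (d k : nat) (gens : 'I_k -> 'rV[int]_d)
  (HZC : generates_group gens)
  (R : realFieldType) (t : nat) (h : 'I_t -> 'rV[R]_d)
  (Hh : facet_system gens h)
  (M : 'rV[int]_d -> lmodType K) (act : forall a b, {linear M a -> M b})
  (HM : graded_module gens act) (HCbar : Cbar_graded R gens M).
Local Notation C := (inC gens).
Local Notation sh := (shift gens).
Local Notation hz j a := (hf (h j) (toR R a)).
Implicit Types (T S U : {set 'I_k}) (a : 'rV[int]_d).

(* By the C-bar-grading, the localisation of M at x^(gsum S) vanishes in degree a
   unless S covers a. *)
Definition covers S a := forall j, hz j a < 0 -> 0 < hz j (gsum gens S).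

Lemma hz_gsum_ge0 j S : 0 <= hz j (gsum gens S).
Proof. exact: (hz_ge0 Hh j (inC_gsum gens S)). Qed.

Lemma uncovered_eq0 S a n : ~ covers S a -> forall v : M (sh a n S), v = 0.
Proof.
move=> /existsNP[j /not_implyP[aj Sj]]; apply: HCbar => /(proj1 Hh)/(_ j).
rewrite hzD hzMn (_ : hz j (gsum gens S) = 0) ?mul0r ?addr0 ?leNgt ?aj //.
by apply/eqP; rewrite eq_le hz_gsum_ge0 andbT leNgt; apply/negP.
Qed.

(* On the S covering a, x^w is invertible in the localisation at x^(gsum S); all
   other localisations vanish in the degrees a and a - w. *)
Lemma H_vanishes_shift i a w : C w -> (forall j, 0 < hz j w -> hz j a < 0) ->
  H_vanishes gens act i (a - w) -> H_vanishes gens act i a.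
Proof.
move=> Cw wa Hv n f cf; set a' := a - w in Hv *.
(* Since h_j(w) >= 0, each h_j negative on a is negative on a - w too. *)
have ca' S : ~ covers S a -> ~ covers S a'.
  move=> nc c; apply: nc => j aj; apply: c; rewrite hzB.
  by apply: le_lt_trans aj; rewrite gerBl; apply: hz_ge0 Hh _ _ Cw.
have shB S m q : sh a' (q + m) S - sh a q S = gsum gens S *+ m - w.
  rewrite /a' /shift mulrnDr opprD addrACA [gsum _ _ *+ q + _]addrC addrK.
  by rewrite [a - w - a]addrAC subrr add0r addrC.
have HB S : exists B : nat, covers S a -> C (gsum gens S *+ B - w).
  have [c|nc] := pselect (covers S a); last by exists 0%N => /nc.
  have [B CB] := inC_gsum_sub HZC Hh Cw (fun j wj => c j (wa j wj)).
  by exists B.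
have [Bf BfP] := choice HB.
pose B := (\max_S Bf S)%N.
have CB S q m : covers S a -> (q + B <= m)%N -> C (sh a' m S - sh a q S).
  move=> /BfP CS qm; have le : (q + Bf S <= m)%N.
    by apply: leq_trans qm; rewrite leq_add2l; apply: leq_bigmax.
  apply: (@inC_sub_trans _ _ _ (sh a' (q + Bf S) S)); last exact: inC_shift.
  by rewrite shB.
have Ca' m S : C (sh a m S - sh a' m S).
  by rewrite -{1}(subrK w a) shift_addl.
pose m := (n + B)%N.
(* Division by x^w: on covering S the larger exponent m absorbs -w, and on the other S the cochain
   is zero. *)
pose f' S := act (sh a n S) (sh a' m S) (f S).
have cf' : is_cocycle act i f'.
  move=> T cT; have [N1 [nN1 e]] := cf T cT.
  exists (m + N1)%N; split; first exact: leq_addr.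
  have [cT'|/ca' ncT] := pselect (covers T a); last exact: uncovered_eq0 ncT _.
  rewrite (@cech_d_act _ _ _ _ _ act a n a' m f) => [|j jT].
    rewrite (act_comp HM); [|exact: CB|by apply: inC_shift; rewrite leq_addr].
    rewrite -(act_comp HM (b := sh a N1 T)) ?e ?linear0 //; first exact: inC_shift.
    by apply: CB => //; rewrite addnC leq_add2r leq_addl.
  (* A face of T may fail to cover a even if T covers it; f vanishes there. *)
  have [cj|ncj] := pselect (covers (T :\ j) a); last first.
    by rewrite /f' (uncovered_eq0 ncj (f _)) !linear0.
  rewrite /f' !(act_comp HM) //; try exact: CB; exact: inC_shiftD1.
have [n' [g fg]] := Hv m f' cf'.
(* Multiplication by x^w brings g back to degree a. *)
exists n', (fun S => act (sh a' n' S) (sh a n' S) (g S)) => S cS.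
have [N [mN n'N e]] := fg S cS.
have nN : (n <= N)%N by apply: leq_trans mN; apply: leq_addr.
exists N; split=> //.
have [c|nc] := pselect (covers S a); last first.
  by rewrite [LHS](uncovered_eq0 nc) [RHS](uncovered_eq0 nc).
rewrite (cech_d_mul HM) // (act_comp HM) //; last exact: inC_shift.
rewrite -[RHS](act_comp HM (b := sh a' N S)) //; last exact: inC_shift.
rewrite -e !(act_comp HM) //; try exact: CB; try exact: inC_shift.
apply: inC_sub_trans (Ca' N S); exact: inC_shift.
Qed.
End Periodicity.

(** * The degrees in and outside Psi, and the criterion *)

Lemma subMn_notin (d : nat) (D : seq 'rV[int]_d) (a c : 'rV[int]_d) : c != 0 ->
  exists q : nat, a - c *+ q \notin D.
Proof.
move=> c0; apply: contrapT => /forallNP H.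
have inj : injective (fun q : nat => a - c *+ q).
  move=> q q' /addrI/oppr_inj; have [i ci] : exists i, c 0 i != 0.
    apply: contrapT => /forallNP c00; case/eqP: c0; apply/rowP => i.
    by rewrite mxE; apply/eqP; apply: contrapT => /negP /c00.
  by move/rowP/(_ i); rewrite !mulmxnE; apply: mulrIn.
have : (size [seq (a - c *+ q)%R | q <- iota 0 (size D).+1] <= size D)%N.
  apply: uniq_leq_size; first by rewrite (map_inj_uniq inj) iota_uniq.
  by move=> _ /mapP[q _ ->]; apply/negPn/negP/H.
by rewrite size_map size_iota ltnn.
Qed.

(** A finite set of degrees misses some a - q c because c is nonzero. The cohomology vanishes there,
    and periodicity carries this back to a. *)
Lemma H_vanishes_Psi (K : fieldType) (d k : nat) (gens : 'I_k -> 'rV[int]_d)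
  (HZC : generates_group gens) (R : realFieldType) (t : nat) (h : 'I_t -> 'rV[R]_d)
  (Hh : facet_system gens h) (M : 'rV[int]_d -> lmodType K)
  (act : forall a b, {linear M a -> M b}) (HM : graded_module gens act)
  (HCbar : Cbar_graded R gens M) (i : nat) (a : 'rV[int]_d) :
  H_finite_length gens act i -> Psi gens h a -> H_vanishes gens act i a.
Proof.
move=> [D [HD _]] [c [Cc [c0 ca]]].
have [q /HD] := subMn_notin D a c0.
apply: (H_vanishes_shift HZC Hh) => //; first exact: inCMn.
move=> j; rewrite hzMn => cq; have := ca j; rewrite hzN oppr_gt0; apply.
by rewrite lt_def (hz_ge0 Hh j Cc) andbT; apply: contraTneq cq => ->; rewrite mul0r ltxx.
Qed.

Lemma finite_outside_Psi (d k : nat) (gens : 'I_k -> 'rV[int]_d)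
  (Hgens0 : forall l, gens l != 0) (HZC : generates_group gens)
  (R : realFieldType) (t : nat) (h : 'I_t -> 'rV[R]_d) (Hh : facet_system gens h)
  (D : seq 'rV[int]_d) : exists D' : seq 'rV[int]_d, forall e a,
  e \in D -> inC gens (e - a) -> ~ Psi gens h a -> a \in D'.
Proof.
have HB e : exists B : nat, forall l j, 0 < hf (h j) (toR R (gens l)) ->
    hf (h j) (toR R e) < hf (h j) (toR R (gens l)) * B%:R.
  have H (x : 'I_k * 'I_t) : exists B : nat, 0 < hf (h x.2) (toR R (gens x.1)) ->
      hf (h x.2) (toR R e) < hf (h x.2) (toR R (gens x.1)) * B%:R.
    have [gx|gx] := ltrP 0 (hf (h x.2) (toR R (gens x.1))); last by exists 0%N.
    by have [B] := hz_archimedean HZC Hh e gx; exists B.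
  have [Bf BfP] := choice H; exists (\max_x Bf x)%N => l j gl.
  apply: lt_le_trans (BfP (l, j) gl) _.
  by rewrite ler_pM2l // ler_nat (leq_bigmax (l, j)).
have [Bf BfP] := choice HB.
pose B := (\max_(e <- D) Bf e)%N.
pose point (e : 'rV[int]_d) (m : {ffun 'I_k -> 'I_B.+1}) := e - \sum_l gens l *+ m l.
exists [seq point e m | e <- D, m <- enum {: {ffun 'I_k -> 'I_B.+1}}].
move=> e a eD [m em] nPsi.
(* If m l exceeds B, then [gens l] witnesses Psi: in h_j(-a) = h_j(e - a) - h_j(e), the term of
   [gens l] alone exceeds h_j(e). *)
have mB l : (m l < B.+1)%N.
  rewrite ltnNge; apply/negP => Bm; apply: nPsi.
  exists (gens l); split; first exact: inC_gen.
  split=> // j gl; have -> : - a = (e - a) - e by rewrite addrAC subrr add0r.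
  rewrite hzB em hz_sum (bigD1 l) //= subr_gt0.
  apply: lt_le_trans (BfP e l j gl) _; rewrite hzMn -[leLHS]addr0 lerD //.
    rewrite ler_pM2l // ler_nat; apply: leq_trans (ltnW Bm).
    exact: leq_bigmax_seq.
  by apply: sumr_ge0 => x _; apply: (hz_ge0 Hh); apply/inCMn/inC_gen.
apply/allpairsP; exists (e, [ffun l => Ordinal (mB l)]) => /=; split=> //.
  by rewrite mem_enum.
rewrite /point (eq_bigr (fun l => gens l *+ m l)) => [|l _]; last by rewrite ffunE.
by rewrite -em opprB addrC subrK.
Qed.

Theorem theorem7p5 (K : fieldType) (d k : nat) (gens : 'I_k -> 'rV[int]_d)
  (Hgens0 : forall l, gens l != 0)
  (HZC : generates_group gens) (Hpt : pointed gens)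
  (R : realFieldType) (t : nat) (h : 'I_t -> 'rV[R]_d)
  (Hh : facet_system gens h)
  (M : 'rV[int]_d -> lmodType K) (act : forall a b, {linear M a -> M b})
  (HM : graded_module gens act) (Hfg : fin_gen gens act)
  (HCbar : Cbar_graded R gens M)
  (i : nat) :
  H_finite_length gens act i <->
  (forall a : 'rV[int]_d, Psi gens h a -> H_vanishes gens act i a).
Proof.
split=> [fl a|HPsi]; first exact: (H_vanishes_Psi HZC Hh HM HCbar).
have [D DP] := Cech_bounded_above HM Hfg.
have [D' D'P] := finite_outside_Psi Hgens0 HZC Hh D.
exists D'; split=> [a aD'|a]; last exact: Cech_findim.
have [/HPsi//|nPsi] := pselect (Psi gens h a).
apply: DP => e eD Cea; move/negP: aD'; apply.
exact: (D'P e a eD Cea nPsi).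
Qed.
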